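(* Let $\Sigma$ be a non-developable ruled Ricci surface in $\mathbb{R}^3$, given by a canonical parametrization $X(t,u)=\alpha(t)+uB(t)$, $(t,u)\in I\times J$. Then the mean curvature of $\Sigma$ is \[H(t,u) = -\frac{\kappa(t)}{2\sqrt{1 + \tau_0^2u^2}},\] where $\kappa$ and $\tau_0$ are respectively the curvature and the (constant) torsion of the line of striction $\alpha$. In particular, the only non-developable ruled Ricci surface with constant mean curvature is the helicoid, i.e. a non-developable ruled Ricci surface has constant mean curvature if and only if it is a piece of helicoid.
   Context: $I,J\subset\mathbb{R}$ are open intervals and all curves and maps are smooth; $\wedge$ is the cross product. Ruled surfaces are assumed non-cylindrical and parametrized as follows: a ruled surface $\Sigma$ is a surface parametrized by an immersion $X:I\times J\to\mathbb{R}^3$, $X(t,u)=\alpha(t)+u\beta(t)$, where, after a regular reparametrization of $t$, $\alpha:I\to\mathbb{R}^3$ and $\beta:I\to\mathbb{S}^2$ satisfy $\|\beta(t)\|=\|\beta'(t)\|=1$ and $\langle\alpha'(t),\beta'(t)\rangle=0$ for all $t\in I$. The curve $\alpha$ is called the line of striction. With this normalization there is a unique function $\lambda:I\to\mathbb{R}$ with $\alpha'\wedge\beta=\lambda\beta'$, called the distribution parameter; $\Sigma$ is non-developable if $\lambda$ does not vanish identically. A ruled Ricci surface is a ruled surface in $\mathbb{R}^3$ whose induced metric satisfies $K\Delta K - \|\nabla K\|^2 - 4K^3 = 0$, where $K$ is the Gauss curvature, $\nabla$ the gradient and $\Delta=\mathrm{div}\,\nabla$ the Laplace–Beltrami operator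 of the induced metric. The curvature $\kappa$, torsion $\tau$ and Frenet frame $\{T,N,B\}$ of a regular curve $\alpha$ are computed with respect to arc length $s$: $T=d\alpha/ds$, $B=T\wedge N$, and \[\frac{dT}{ds}=\kappa N,\qquad \frac{dN}{ds}=-\kappa T-\tau B,\qquad \frac{dB}{ds}=\tau N.\] A canonical parametrization of a non-developable ruled Ricci surface is a parametrization $X(t,u)=\alpha(t)+uB(t)$ where $\alpha$ is a regular curve of constant torsion and $B$ is its binormal. There are two cases: either $\kappa$ has no zeros, the torsion of $\alpha$ is a non-zero constant $\tau_0$, and $B$ is the usual binormal; or $\alpha$ is a straight line, $\Sigma$ is a piece of helicoid, and ''binormal'' means the great circle in $\mathbb{S}^2$ orthogonal to the line that generates the helicoid together with $\alpha$; in this second case $\kappa\equiv 0$ and the formula for $H$ is read as $H=0$. The mean curvature $H$ is half the trace of the second fundamental form with respect to the first, $\langle X_{ij},N_\Sigma\rangle$ being the coefficients of the second fundamental form, computed with the unit normal $N_\Sigma=\dfrac{X_t\wedge X_u}{\|X_t\wedge X_u\|}$, where $t$ is an increasing function of the arc length of $\alpha$ used to define $T$. A piece of helicoid is, up to a rigid motion (isometry) of $\mathbb{R}^3$, a surface parametrized by $(t,u)\mapsto(0,0,at+b)+u(\cos t,\sin t,0)$, $(t,u)\in I\times J$, for constants $a\neq0$ and $b$. *)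

(* Defs.v *)
(* Stdlib reals with Coquelicot's total derivative [Derive]. *)
From Stdlib Require Import Reals.
From Coquelicot Require Import Coquelicot.
Open Scope R_scope.

(** * Euclidean space *)

Definition vec3 : Type := (R * R * R)%type.

Definition cx (p : vec3) : R := fst (fst p).
Definition cy (p : vec3) : R := snd (fst p).
Definition cz (p : vec3) : R := snd p.

Definition vzero : vec3 := (0, 0, 0).
Definition vadd (p q : vec3) : vec3 := (cx p + cx q, cy p + cy q, cz p + cz q).
Definition vscal (a : R) (p : vec3) : vec3 := (a * cx p, a * cy p, a * cz p).
Definition vsub (p q : vec3) : vec3 := vadd p (vscal (-1) q).
Definition dot (p q : vec3) : R := cx p * cx q + cy p * cy q + cz p * cz q.
Definition cross (p q : vec3) : vec3 :=
  (cy p * cz q - cz p * cy q,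
   cz p * cx q - cx p * cz q,
   cx p * cy q - cy p * cx q).
Definition vnorm (p : vec3) : R := sqrt (dot p p).

Definition isometry (phi : vec3 -> vec3) : Prop :=
  forall p q, vnorm (vsub (phi p) (phi q)) = vnorm (vsub p q).

(** * Intervals, smoothness *)

(* Nonempty, possibly unbounded. *)
Definition open_interval (I : R -> Prop) : Prop :=
  exists a b : Rbar, Rbar_lt a b /\
    forall t : R, I t <-> Rbar_lt a (Finite t) /\ Rbar_lt (Finite t) b.

Definition smooth_on (I : R -> Prop) (f : R -> R) : Prop :=
  forall (n : nat) (t : R), I t -> ex_derive_n f n t.

Definition vsmooth_on (I : R -> Prop) (c : R -> vec3) : Prop :=
  smooth_on I (fun t => cx (c t)) /\
  smooth_on I (fun t => cy (c t)) /\
  smooth_on I (fun t => cz (c t)).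

Definition vderive (c : R -> vec3) (t : R) : vec3 :=
  (Derive (fun s => cx (c s)) t,
   Derive (fun s => cy (c s)) t,
   Derive (fun s => cz (c s)) t).

(** * Frenet apparatus of a curve, with respect to arc length *)

Definition speed (alpha : R -> vec3) (t : R) : R := vnorm (vderive alpha t).

(* d/ds, with s the arc length of [alpha], increasing in the parameter. *)
Definition arc_derive (alpha c : R -> vec3) (t : R) : vec3 :=
  vscal (/ speed alpha t) (vderive c t).

Definition regular_curve (I : R -> Prop) (alpha : R -> vec3) : Prop :=
  vsmooth_on I alpha /\ forall t, I t -> vderive alpha t <> vzero.

Definition tangent (alpha : R -> vec3) (t : R) : vec3 :=
  arc_derive alpha alpha t.
Definition curvature (alpha : R -> vec3) (t : R) : R :=
  vnorm (arc_derive alpha (tangent alpha) t).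
Definition normal (alpha : R -> vec3) (t : R) : vec3 :=
  vscal (/ curvature alpha t) (arc_derive alpha (tangent alpha) t).
Definition binormal (alpha : R -> vec3) (t : R) : vec3 :=
  cross (tangent alpha t) (normal alpha t).
(* Sign convention dB/ds = tau N. *)
Definition torsion (alpha : R -> vec3) (t : R) : R :=
  dot (arc_derive alpha (binormal alpha) t) (normal alpha t).

(** * Geometry of a parametrized surface *)

Definition D1 (f : R -> R -> R) (t u : R) : R := Derive (fun s => f s u) t.
Definition D2 (f : R -> R -> R) (t u : R) : R := Derive (fun v => f t v) u.
Definition V1 (X : R -> R -> vec3) (t u : R) : vec3 := vderive (fun s => X s u) t.
Definition V2 (X : R -> R -> vec3) (t u : R) : vec3 := vderive (fun v => X t v) u.

Definition immersion_on (I J : R -> Prop) (X : R -> R -> vec3) : Prop :=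
  forall t u, I t -> J u -> cross (V1 X t u) (V2 X t u) <> vzero.

Definition fffE (X : R -> R -> vec3) (t u : R) : R := dot (V1 X t u) (V1 X t u).
Definition fffF (X : R -> R -> vec3) (t u : R) : R := dot (V1 X t u) (V2 X t u).
Definition fffG (X : R -> R -> vec3) (t u : R) : R := dot (V2 X t u) (V2 X t u).
Definition fffdet (X : R -> R -> vec3) (t u : R) : R :=
  fffE X t u * fffG X t u - fffF X t u * fffF X t u.

Definition unit_normal (X : R -> R -> vec3) (t u : R) : vec3 :=
  vscal (/ vnorm (cross (V1 X t u) (V2 X t u))) (cross (V1 X t u) (V2 X t u)).

Definition sffL (X : R -> R -> vec3) (t u : R) : R :=
  dot (V1 (V1 X) t u) (unit_normal X t u).
Definition sffM (X : R -> R -> vec3) (t u : R) : R :=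
  dot (V2 (V1 X) t u) (unit_normal X t u).
Definition sffN (X : R -> R -> vec3) (t u : R) : R :=
  dot (V2 (V2 X) t u) (unit_normal X t u).

Definition gauss_curvature (X : R -> R -> vec3) (t u : R) : R :=
  (sffL X t u * sffN X t u - sffM X t u * sffM X t u) / fffdet X t u.

(* Half the trace of the matrix (first form)^-1 (second form). *)
Definition mean_curvature (X : R -> R -> vec3) (t u : R) : R :=
  (fffG X t u * sffL X t u - 2 * fffF X t u * sffM X t u
     + fffE X t u * sffN X t u) / fffdet X t u / 2.

(* Components of the gradient in the coordinate basis (X_t, X_u). *)
Definition grad1 (X : R -> R -> vec3) (f : R -> R -> R) (t u : R) : R :=
  (fffG X t u * D1 f t u - fffF X t u * D2 f t u) / fffdet X t u.
Definition grad2 (X : R -> R -> vec3) (f : R -> R -> R) (t u : R) : R :=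
  (fffE X t u * D2 f t u - fffF X t u * D1 f t u) / fffdet X t u.

Definition grad_norm2 (X : R -> R -> vec3) (f : R -> R -> R) (t u : R) : R :=
  fffE X t u * grad1 X f t u ^ 2
  + 2 * fffF X t u * grad1 X f t u * grad2 X f t u
  + fffG X t u * grad2 X f t u ^ 2.

(* Divergence of the tangent field v1 X_t + v2 X_u. *)
Definition divergence (X : R -> R -> vec3) (v1 v2 : R -> R -> R) (t u : R) : R :=
  (D1 (fun s w => sqrt (fffdet X s w) * v1 s w) t u
   + D2 (fun s w => sqrt (fffdet X s w) * v2 s w) t u) / sqrt (fffdet X t u).

Definition laplacian (X : R -> R -> vec3) (f : R -> R -> R) (t u : R) : R :=
  divergence X (grad1 X f) (grad2 X f) t u.

Definition ricci_condition (I J : R -> Prop) (X : R -> R -> vec3) : Prop :=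
  forall t u, I t -> J u ->
    gauss_curvature X t u * laplacian X (gauss_curvature X) t u
    - grad_norm2 X (gauss_curvature X) t u
    - 4 * gauss_curvature X t u ^ 3 = 0.

Definition constant_mean_curvature (I J : R -> Prop) (X : R -> R -> vec3) : Prop :=
  exists H0 : R, forall t u, I t -> J u -> mean_curvature X t u = H0.

Definition image (I J : R -> Prop) (X : R -> R -> vec3) (p : vec3) : Prop :=
  exists t u, I t /\ J u /\ p = X t u.

(** * Ruled surfaces *)

Definition ruled (alpha beta : R -> vec3) (t u : R) : vec3 :=
  vadd (alpha t) (vscal u (beta t)).

Definition regular_reparametrization (I0 I : R -> Prop) (h : R -> R) : Prop :=
  smooth_on I0 h /\
  (forall s, I0 s -> I (h s) /\ Derive h s <> 0) /\
  (forall t, I t -> exists s, I0 s /\ h s = t).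

Definition striction_normalized (I : R -> Prop) (alpha beta : R -> vec3) : Prop :=
  forall t, I t ->
    vnorm (beta t) = 1 /\ vnorm (vderive beta t) = 1 /\
    dot (vderive alpha t) (vderive beta t) = 0.

Definition ruled_surface (I J : R -> Prop) (alpha beta : R -> vec3) : Prop :=
  open_interval I /\ open_interval J /\
  vsmooth_on I alpha /\ vsmooth_on I beta /\
  immersion_on I J (ruled alpha beta) /\
  exists (I0 : R -> Prop) (h : R -> R),
    open_interval I0 /\ regular_reparametrization I0 I h /\
    striction_normalized I0 (fun s => alpha (h s)) (fun s => beta (h s)).

(* Both sides of the equation are multiplied by the same factor h' under a
   reparametrization h, so lambda may be computed in any regular parameter. *)
Definition distribution_parameter (I : R -> Prop) (alpha beta : R -> vec3)
    (lambda : R -> R) : Prop :=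
  forall t, I t ->
    cross (vderive alpha t) (beta t) = vscal (lambda t) (vderive beta t).

Definition non_developable (I : R -> Prop) (alpha beta : R -> vec3) : Prop :=
  exists lambda : R -> R,
    distribution_parameter I alpha beta lambda /\
    exists t, I t /\ lambda t <> 0.

Definition non_developable_ruled_ricci (I J : R -> Prop)
    (alpha beta : R -> vec3) : Prop :=
  ruled_surface I J alpha beta /\
  non_developable I alpha beta /\
  ricci_condition I J (ruled alpha beta).

(** * Helicoids and canonical parametrizations *)

Definition helicoid (a b t u : R) : vec3 := (u * cos t, u * sin t, a * t + b).

Definition piece_of_helicoid (S : vec3 -> Prop) : Prop :=
  exists (phi : vec3 -> vec3) (a b : R) (I J : R -> Prop),
    isometry phi /\ a <> 0 /\ open_interval I /\ open_interval J /\
    forall p, S p <-> image I J (fun t u => phi (helicoid a b t u)) p.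

(* [beta] is the binormal of [alpha] in the generic case.  When [alpha] is a
   straight line, [beta] runs in the great circle orthogonal to it, [tau0] is
   unconstrained and the curvature is identically zero. *)
Definition canonical_parametrization (I J : R -> Prop)
    (alpha beta : R -> vec3) (tau0 : R) : Prop :=
  regular_curve I alpha /\
  ((tau0 <> 0 /\
    forall t, I t ->
      curvature alpha t <> 0 /\ torsion alpha t = tau0 /\
      beta t = binormal alpha t)
   \/
   ((exists p e : vec3, vnorm e = 1 /\
       forall t, I t ->
         (exists r : R, alpha t = vadd p (vscal r e)) /\
         vnorm (beta t) = 1 /\ dot (beta t) e = 0) /\
    piece_of_helicoid (image I J (ruled alpha beta)))).

(* Main.v *)
Require Import Defs.
From Stdlib Require Import Reals.
From Coquelicot Require Import Coquelicot.
From Stdlib Require Import Lra Psatz.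
(* [open_interval] is also a name in [Reals], for other arguments. *)
Import Defs.
Open Scope R_scope.

(** All computations are made in the given parameter [t], along the line of
striction: |b| = 1, <a', b'> = 0, b' <> 0, conditions which do not depend on
the normalizing reparametrization.  Write w = |b'|, F = <a', b> and let l be
the distribution parameter, so that a' = F b + l (b x b').  The metric is

  E = F^2 + w^2 (l^2 + u^2),  F,  G = 1,   and   K = - l^2 / (l^2 + u^2)^2.

Where l <> 0, the Ricci condition says that log |K| has Laplacian 4 K.  After
clearing denominators this is a polynomial of degree 4 in u with coefficients
depending on t ([ricci_quartic]).  It vanishes on an interval, so all its
coefficients vanish, which forces l' = 0 and F = 0.  Hence (l^2)' = 0 on all of
I, so l is a constant c <> 0 and a' = c (b x b') ([ricci_rigid],
[ricci_striction]).

From that, H = - g / (2 w^3 sqrt (c^2 + u^2)), where g = det (b, b', b'')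
([ruled_mean_curvature]).  The first part follows: in the Frenet case
w = v |tau|, g = v^3 tau^2 kappa and c^2 tau^2 = 1, where v is the speed
([binormal_director]); over a straight line g and kappa are both 0.

For the second part, H can be constant in u only if g = 0.  Then b runs in a
great circle with axis e, a' is c w e, and the angle of b serves as the
parameter of a helicoid ([planar_director_helicoid]).  Conversely, let the
image be a piece of helicoid.  The helicoid lies in the zero set of
x sin ((z - k) / h) - y cos ((z - k) / h), and a line segment inside that set is
horizontal or vertical ([line_in_helicoid]).  Vertical rulings are excluded
because b' <> 0, so b stays in a plane, g = 0 and H = 0
([helicoid_rulings_horizontal]).  This uses only the image, so the two
parametrizations of the surface never have to be compared. *)

(** * Vector algebra and componentwise calculus *)

Ltac coords := unfold vsub, vadd, vscal, cross, dot, vzero, cx, cy, cz in *; simpl in *.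

Lemma vec_ext (p q : vec3) : cx p = cx q -> cy p = cy q -> cz p = cz q -> p = q.
Proof. destruct p as [[? ?] ?], q as [[? ?] ?]; coords; intros; subst; reflexivity. Qed.

Ltac vec_ring := intros; first [apply vec_ext; coords; ring | coords; ring].

Ltac vec_lra E := apply vec_ext;
  [apply (f_equal cx) in E|apply (f_equal cy) in E|apply (f_equal cz) in E];
  clear - E; coords; lra.

Lemma dot_sym p q : dot p q = dot q p.
Proof. vec_ring. Qed.

Lemma dot_nonneg p : 0 <= dot p p.
Proof. destruct p as [[x y] z]; coords; nra. Qed.

Lemma dot_self_eq0 p : dot p p = 0 -> p = vzero.
Proof. destruct p as [[x y] z]; coords; intros; repeat f_equal; nra. Qed.

Lemma dot_self_pos p : p <> vzero -> 0 < dot p p.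
Proof.
intros H; destruct (dot_nonneg p) as [Hp|Hp]; [exact Hp|].
elim H; apply dot_self_eq0; auto.
Qed.

Lemma vnorm_sq p : vnorm p * vnorm p = dot p p.
Proof. apply sqrt_sqrt, dot_nonneg. Qed.

Lemma vnorm_pos p : p <> vzero -> 0 < vnorm p.
Proof. intros H; apply sqrt_lt_R0, dot_self_pos, H. Qed.

Lemma dot_unit p : vnorm p = 1 -> dot p p = 1.
Proof. intros H; rewrite <- vnorm_sq, H; ring. Qed.

Lemma lagrange_identity p q :
  dot (cross p q) (cross p q) = dot p p * dot q q - dot p q * dot p q.
Proof. vec_ring. Qed.

Lemma cross_cross p q r : cross p (cross q r) = vsub (vscal (dot p r) q) (vscal (dot p q) r).
Proof. destruct q as [[? ?] ?], r as [[? ?] ?]; vec_ring. Qed.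

(** Expansion of the fixed vector [e] along the dual basis of [p, q, r]. *)
Lemma triple_expansion e p q r :
  vscal (dot (cross p q) r) e =
  vadd (vscal (dot e p) (cross q r))
    (vadd (vscal (dot e q) (cross r p)) (vscal (dot e r) (cross p q))).
Proof. vec_ring. Qed.

Lemma coplanar_triple e p q r : dot e e <> 0 ->
  dot p e = 0 -> dot q e = 0 -> dot r e = 0 -> dot (cross p q) r = 0.
Proof.
intros He Hp Hq Hr.
assert (H2 : dot (cross p q) r * dot e e = 0).
{ replace (dot (cross p q) r * dot e e) with (dot (vscal (dot (cross p q) r) e) e) by vec_ring.
  rewrite triple_expansion, !(dot_sym e), Hp, Hq, Hr; vec_ring. }
apply Rmult_integral in H2; tauto.
Qed.

(** [Derive] is a total function, so [vderive] does not record differentiability;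
this relation does. *)
Definition has_deriv (c : R -> vec3) (t : R) (d : vec3) : Prop :=
  is_derive (fun s => cx (c s)) t (cx d) /\
  is_derive (fun s => cy (c s)) t (cy d) /\
  is_derive (fun s => cz (c s)) t (cz d).

Lemma has_deriv_unique c t d : has_deriv c t d -> vderive c t = d.
Proof.
intros (H1 & H2 & H3); apply vec_ext; apply is_derive_unique; assumption.
Qed.

Lemma has_deriv_eq c t d d' : has_deriv c t d -> d = d' -> has_deriv c t d'.
Proof. intros H <-; exact H. Qed.

Lemma has_deriv_ext_loc c c' t d : locally t (fun s => c s = c' s) ->
  has_deriv c t d -> has_deriv c' t d.
Proof.
intros Hl (H1 & H2 & H3).
split; [|split]; (eapply is_derive_ext_loc; [|eassumption]); revert Hl;
  apply filter_imp; intros s ->; reflexivity.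
Qed.

Lemma is_derive_eq (f : R -> R) (t d d' : R) : is_derive f t d -> d = d' -> is_derive f t d'.
Proof. intros H <-; exact H. Qed.

Lemma is_derive_Rplus (f g : R -> R) (t df dg : R) : is_derive f t df -> is_derive g t dg ->
  is_derive (fun s => f s + g s) t (df + dg).
Proof. intros; apply (is_derive_plus (V := R_NormedModule)); assumption. Qed.

Lemma is_derive_Rmult (f g : R -> R) (t df dg : R) : is_derive f t df -> is_derive g t dg ->
  is_derive (fun s => f s * g s) t (df * g t + f t * dg).
Proof. intros; apply (is_derive_mult f g); auto; intros; apply Rmult_comm. Qed.

Lemma is_derive_Rminus (f g : R -> R) (t df dg : R) : is_derive f t df -> is_derive g t dg ->
  is_derive (fun s => f s - g s) t (df - dg).
Proof. intros; apply (is_derive_minus (V := R_NormedModule)); assumption. Qed.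

Lemma is_derive_Rconst (k t : R) : is_derive (fun _ => k) t 0.
Proof. apply (is_derive_const (V := R_NormedModule)). Qed.

Lemma has_deriv_dot c d t c' d' : has_deriv c t c' -> has_deriv d t d' ->
  is_derive (fun s => dot (c s) (d s)) t (dot c' (d t) + dot (c t) d').
Proof.
intros (H1 & H2 & H3) (K1 & K2 & K3).
eapply is_derive_eq.
- unfold dot. apply is_derive_Rplus; [apply is_derive_Rplus|]; apply is_derive_Rmult; eassumption.
- unfold dot; ring.
Qed.

Lemma has_deriv_cross c d t c' d' : has_deriv c t c' -> has_deriv d t d' ->
  has_deriv (fun s => cross (c s) (d s)) t (vadd (cross c' (d t)) (cross (c t) d')).
Proof.
intros (H1 & H2 & H3) (K1 & K2 & K3).
split; [|split]; (eapply is_derive_eq;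
 [apply is_derive_Rminus; apply is_derive_Rmult; eassumption | coords; ring]).
Qed.

Lemma has_deriv_scal f c t f' c' : is_derive f t f' -> has_deriv c t c' ->
  has_deriv (fun s => vscal (f s) (c s)) t (vadd (vscal f' (c t)) (vscal (f t) c')).
Proof.
intros Hf (K1 & K2 & K3).
split; [|split]; (eapply is_derive_eq;
 [apply is_derive_Rmult; eassumption | coords; ring]).
Qed.

Lemma has_deriv_add c d t c' d' : has_deriv c t c' -> has_deriv d t d' ->
  has_deriv (fun s => vadd (c s) (d s)) t (vadd c' d').
Proof.
intros (H1 & H2 & H3) (K1 & K2 & K3).
split; [|split]; apply is_derive_Rplus; assumption.
Qed.

Lemma has_deriv_const p t : has_deriv (fun _ => p) t vzero.
Proof. split; [|split]; apply (is_derive_const (V := R_NormedModule)). Qed.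

(** * Intervals and smooth functions *)

Lemma open_interval_locally I t : open_interval I -> I t -> locally t I.
Proof.
intros (a & b & _ & H) Ht.
apply filter_imp with (fun s : R => Rbar_lt a s /\ Rbar_lt s b).
- intros s Hs; apply H, Hs.
- apply H in Ht; apply filter_and; [apply open_Rbar_gt | apply open_Rbar_lt]; apply Ht.
Qed.

Lemma open_interval_between I x y t : open_interval I -> I x -> I y -> x <= t <= y -> I t.
Proof.
intros (a & b & _ & H) Hx Hy Ht.
apply H in Hx; apply H in Hy; apply H; split.
- eapply Rbar_lt_le_trans; [apply Hx | apply Ht].
- eapply Rbar_le_lt_trans; [|apply Hy]; apply Ht.
Qed.

Lemma open_interval_inhabited I : open_interval I -> exists t, I t.
Proof.
intros (a & b & Hab & H).
assert (exists t : R, Rbar_lt a t /\ Rbar_lt t b) as [t Ht].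
{ destruct a as [a| |], b as [b| |]; simpl in *; try tauto.
  - exists ((a + b) / 2); lra.
  - exists (a + 1); split; [lra|auto].
  - exists (b - 1); split; [auto|lra].
  - exists 0; auto. }
exists t; apply H, Ht.
Qed.

Lemma locally_on I t (P : R -> Prop) : open_interval I -> I t ->
  (forall s, I s -> P s) -> locally t P.
Proof.
intros HI Ht HP; generalize (open_interval_locally I t HI Ht); apply filter_imp, HP.
Qed.

Lemma derive_zero_constant I f : open_interval I ->
  (forall t, I t -> is_derive f t 0) -> forall x y, I x -> I y -> f x = f y.
Proof.
intros HI Hf.
assert (Hlt : forall x y, I x -> I y -> x < y -> f x = f y).
{ intros x y Hx Hy Hxy; apply (eq_is_derive (V := R_NormedModule) f); [|exact Hxy].
  intros t Ht; apply Hf, (open_interval_between I x y); auto. }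
intros x y Hx Hy; destruct (Rtotal_order x y) as [H|[->|H]]; auto; symmetry; auto.
Qed.

Lemma zero_on_derive I f : open_interval I -> (forall t, I t -> f t = 0) ->
  forall t d, I t -> is_derive f t d -> d = 0.
Proof.
intros HI Hf t d Ht Hd; apply is_derive_unique in Hd; rewrite <- Hd.
rewrite (Derive_ext_loc f (fun _ => 0)); [apply Derive_const|].
apply (locally_on I); auto.
Qed.

(** A polynomial vanishing on an open interval is zero: its successive
derivatives vanish there as well. *)
Lemma quartic_vanishing J c0 c1 c2 c3 c4 : open_interval J ->
  (forall u, J u -> c0 + c1 * u + c2 * u ^ 2 + c3 * u ^ 3 + c4 * u ^ 4 = 0) ->
  c0 = 0 /\ c1 = 0 /\ c2 = 0 /\ c3 = 0 /\ c4 = 0.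
Proof.
intros HJ H0.
assert (H1 : forall u, J u -> c1 + 2 * c2 * u + 3 * c3 * u ^ 2 + 4 * c4 * u ^ 3 = 0).
{ intros u Hu; apply (zero_on_derive J _ HJ H0 u); auto; auto_derive; [exact Logic.I|ring]. }
assert (H2 : forall u, J u -> 2 * c2 + 6 * c3 * u + 12 * c4 * u ^ 2 = 0).
{ intros u Hu; apply (zero_on_derive J _ HJ H1 u); auto; auto_derive; [exact Logic.I|ring]. }
assert (H3 : forall u, J u -> 6 * c3 + 24 * c4 * u = 0).
{ intros u Hu; apply (zero_on_derive J _ HJ H2 u); auto; auto_derive; [exact Logic.I|ring]. }
assert (H4 : forall u, J u -> 24 * c4 = 0).
{ intros u Hu; apply (zero_on_derive J _ HJ H3 u); auto; auto_derive; [exact Logic.I|ring]. }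
destruct (open_interval_inhabited J HJ) as [u Hu].
specialize (H0 u Hu); specialize (H1 u Hu); specialize (H2 u Hu);
  specialize (H3 u Hu); specialize (H4 u Hu).
assert (E4 : c4 = 0) by lra; subst c4.
assert (E3 : c3 = 0) by lra; subst c3.
assert (E2 : c2 = 0) by lra; subst c2.
assert (E1 : c1 = 0) by lra; subst c1.
lra.
Qed.

Lemma smooth_is_derive I f t : smooth_on I f -> I t -> is_derive f t (Derive f t).
Proof. intros H Ht; apply Derive_correct, (H 1%nat t Ht). Qed.

Lemma smooth_Derive I f : smooth_on I f -> smooth_on I (Derive f).
Proof.
intros H n t Ht; destruct n as [|n]; [exact Logic.I|].
generalize (H (S (S n)) t Ht); simpl; apply ex_derive_ext.
intros s; generalize (Derive_n_comp f n 1 s); rewrite Nat.add_1_r; simpl; auto.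
Qed.

Lemma vsmooth_has_deriv I c t : vsmooth_on I c -> I t -> has_deriv c t (vderive c t).
Proof.
intros (H1 & H2 & H3) Ht; split; [|split]; eapply smooth_is_derive; eassumption.
Qed.

Lemma vsmooth_vderive I c : vsmooth_on I c -> vsmooth_on I (vderive c).
Proof. intros (H1 & H2 & H3); split; [|split]; apply smooth_Derive; assumption. Qed.

(** * The Ricci condition for the metric of a ruled surface *)

(** Here [l], [F], [w] are functions of [t] alone.  With D = l^2 + u^2, the
logarithm of |K| is 2 (log |l| - log D), and its Laplacian minus 4 K is
2 P / (w D^3), where P is the polynomial in [u] of the conclusion.  The
abbreviations [p] and [q] are (log |l|)' / w and F / w, that is, the quantities
(log |l|)' and F in the parameter for which |b'| = 1.  The proof works with [K]
instead of its logarithm, since [l] may vanish at other values of [t]. *)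
Lemma ricci_quartic I J X (l l1 l2 F F1 w w1 : R -> R) :
  open_interval I -> open_interval J ->
  (forall t, I t -> is_derive l t (l1 t) /\ is_derive l1 t (l2 t) /\
     is_derive F t (F1 t) /\ is_derive w t (w1 t) /\ 0 < w t) ->
  (forall t u, I t -> J u -> 0 < l t ^ 2 + u ^ 2 /\
     fffE X t u = F t ^ 2 + w t ^ 2 * (l t ^ 2 + u ^ 2) /\
     fffF X t u = F t /\ fffG X t u = 1 /\
     gauss_curvature X t u = - l t ^ 2 / (l t ^ 2 + u ^ 2) ^ 2) ->
  ricci_condition I J X ->
  forall t, I t -> l t <> 0 ->
  let p := l1 t / (l t * w t) in
  let p1 := (l2 t * (l t * w t) - l1 t * (l1 t * w t + l t * w1 t)) / (l t * w t) ^ 2 in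
  let q := F t / w t in
  let q1 := (F1 t * w t - F t * w1 t) / w t ^ 2 in
  forall u, J u ->
  (p1 * (u ^ 2 - l t ^ 2) - 2 * w t * p ^ 2 * l t ^ 2 + 2 * u * q1
     - w t * q * (2 * p * u + 2 * q)) * (l t ^ 2 + u ^ 2)
  + 3 * w t * (p * (u ^ 2 - l t ^ 2) + 2 * u * q) * (u * q - p * l t ^ 2) = 0.
Proof.
intros HI HJ Hd HX HR t Ht Hl p p1 q q1 u Hu.
set (D := fun t u => l t ^ 2 + u ^ 2).
assert (HD : forall s v, I s -> J v -> 0 < D s v) by (intros s v Hs Hv; apply HX; auto).
assert (HK1 : forall s v, I s -> J v -> D1 (gauss_curvature X) s v =
  - 2 * l s * l1 s * (v ^ 2 - l s ^ 2) / D s v ^ 3).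
{ intros s v Hs Hv; unfold D1.
  rewrite (Derive_ext_loc _ (fun s => - l s ^ 2 / (l s ^ 2 + v ^ 2) ^ 2)).
  2: apply (locally_on I); auto; intros r Hr; apply HX; auto.
  generalize (HD s v Hs Hv); unfold D; intros HDs.
  destruct (Hd s Hs) as (Hd1 & _).
  apply is_derive_unique; auto_derive.
  - repeat split; try (eexists; eassumption);
      apply Rgt_not_eq; repeat apply Rmult_lt_0_compat; nra.
  - rewrite (is_derive_unique (fun x : R => l x) _ _ Hd1). field; nra. }
assert (HK2 : forall s v, I s -> J v -> D2 (gauss_curvature X) s v =
  4 * l s ^ 2 * v / D s v ^ 3).
{ intros s v Hs Hv; unfold D2.
  rewrite (Derive_ext_loc _ (fun v => - l s ^ 2 / (l s ^ 2 + v ^ 2) ^ 2)).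
  2: apply (locally_on J); auto; intros r Hr; apply HX; auto.
  generalize (HD s v Hs Hv); unfold D; intros HDs.
  apply is_derive_unique; auto_derive.
  - apply Rgt_not_eq; repeat apply Rmult_lt_0_compat; nra.
  - field; nra. }
assert (Hdet : forall s v, I s -> J v -> fffdet X s v = w s ^ 2 * D s v).
{ intros s v Hs Hv; unfold fffdet; destruct (HX s v Hs Hv) as (_ & -> & -> & -> & _).
  unfold D; ring. }
assert (Hsq : forall s v, I s -> J v -> sqrt (fffdet X s v) = w s * sqrt (D s v)).
{ intros s v Hs Hv; rewrite Hdet by auto.
  destruct (Hd s Hs) as (_ & _ & _ & _ & Hw).
  rewrite sqrt_mult; [|nra|apply Rlt_le, HD; auto].
  rewrite sqrt_pow2 by lra; reflexivity. }
(* With f = (log |K|) / 2, one has f_t - F f_u = w N / (l^2 D). *)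
set (N := fun s v => l s * l1 s / w s * (v ^ 2 - l s ^ 2) + 2 * v * (F s / w s) * l s ^ 2).
assert (HA : forall s v, I s -> J v ->
  sqrt (fffdet X s v) * grad1 X (gauss_curvature X) s v =
  - 2 * N s v / (D s v ^ 3 * sqrt (D s v))).
{ intros s v Hs Hv; unfold grad1; rewrite Hsq, Hdet, HK1, HK2 by auto.
  destruct (HX s v Hs Hv) as (_ & _ & -> & -> & _).
  destruct (Hd s Hs) as (_ & _ & _ & _ & Hw).
  generalize (HD s v Hs Hv); intros HDs.
  assert (HS := sqrt_lt_R0 _ HDs).
  assert (HSS := sqrt_sqrt _ (Rlt_le _ _ HDs)).
  set (S := sqrt (D s v)) in *. rewrite <- HSS. unfold N. field. lra. }
assert (HB : forall s v, I s -> J v ->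
  sqrt (fffdet X s v) * grad2 X (gauss_curvature X) s v =
  (4 * l s ^ 2 * v * w s * D s v + 2 * F s * N s v) / (D s v ^ 3 * sqrt (D s v))).
{ intros s v Hs Hv; unfold grad2; rewrite Hsq, Hdet, HK1, HK2 by auto.
  destruct (HX s v Hs Hv) as (_ & -> & -> & _ & _).
  destruct (Hd s Hs) as (_ & _ & _ & _ & Hw).
  generalize (HD s v Hs Hv); intros HDs.
  assert (HS := sqrt_lt_R0 _ HDs).
  assert (HSS := sqrt_sqrt _ (Rlt_le _ _ HDs)).
  change (l s ^ 2 + v ^ 2) with (D s v).
  set (S := sqrt (D s v)) in *. rewrite <- HSS. unfold N. field. lra. }
generalize (HD t u Ht Hu); intros HDs.
destruct (Hd t Ht) as (Hd1 & Hd2 & Hd3 & Hd4 & Hw).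
assert (HS := sqrt_lt_R0 _ HDs).
assert (HSS := sqrt_sqrt _ (Rlt_le _ _ HDs)).
assert (HA1 : Derive (fun s => sqrt (fffdet X s u) * grad1 X (gauss_curvature X) s u) t =
  - 2 * (((l1 t ^ 2 + l t * l2 t) / w t * (u ^ 2 - l t ^ 2) - l t * l1 t * w1 t / w t ^ 2 * (u ^ 2 - l t ^ 2)
      - 2 * l t ^ 2 * l1 t ^ 2 / w t + 2 * u * q1 * l t ^ 2 + 4 * u * q * l t * l1 t) * D t u
     - 7 * N t u * l t * l1 t) / (D t u ^ 4 * sqrt (D t u))).
{ rewrite (Derive_ext_loc _ (fun s => - 2 * N s u / (D s u ^ 3 * sqrt (D s u)))).
  2: apply (locally_on I); auto.
  apply is_derive_unique. unfold N, D; auto_derive; fold (D t u).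
  - change (l t * (l t * 1) + u * (u * 1)) with (D t u).
    repeat split; try (eexists; eassumption); try lra; try nra.
    apply Rgt_not_eq. apply Rmult_lt_0_compat; auto. apply Rmult_lt_0_compat; nra.
  - change (l t * (l t * 1) + u * (u * 1)) with (D t u).
    rewrite (is_derive_unique (fun x : R => l x) _ _ Hd1), (is_derive_unique (fun x : R => l1 x) _ _ Hd2),
     (is_derive_unique (fun x : R => F x) _ _ Hd3), (is_derive_unique (fun x : R => w x) _ _ Hd4).
    set (S := sqrt (D t u)) in *. rewrite <- HSS. unfold q, q1. field. lra. }
assert (HB1 : Derive (fun v => sqrt (fffdet X t v) * grad2 X (gauss_curvature X) t v) u =
  ((4 * l t ^ 2 * w t * D t u + 8 * l t ^ 2 * w t * u ^ 2
      + 2 * F t * (2 * u * (l t * l1 t) / w t + 2 * q * l t ^ 2)) * D t u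
   - 7 * u * (4 * l t ^ 2 * u * w t * D t u + 2 * F t * N t u)) / (D t u ^ 4 * sqrt (D t u))).
{ rewrite (Derive_ext_loc _ (fun v =>
    (4 * l t ^ 2 * v * w t * D t v + 2 * F t * N t v) / (D t v ^ 3 * sqrt (D t v)))).
  2: apply (locally_on J); auto.
  apply is_derive_unique. unfold N, D; auto_derive.
  - change (l t * (l t * 1) + u * (u * 1)) with (D t u).
    repeat split; try lra; try nra.
    apply Rgt_not_eq. apply Rmult_lt_0_compat; auto. apply Rmult_lt_0_compat; nra.
  - change (l t * (l t * 1) + u * (u * 1)) with (D t u).
    change (l t ^ 2 + u ^ 2) with (D t u).
    set (S := sqrt (D t u)) in *. rewrite <- HSS. unfold q. field. lra. }
specialize (HR t u Ht Hu).
unfold laplacian, divergence, D1, D2, grad_norm2 in HR.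
rewrite HA1, HB1, Hsq in HR by auto.
assert (HA0 : grad1 X (gauss_curvature X) t u =
  - 2 * N t u / (D t u ^ 3 * sqrt (D t u)) / (w t * sqrt (D t u))).
{ rewrite <- HA, <- Hsq by auto. field. rewrite Hsq by auto. nra. }
assert (HB0 : grad2 X (gauss_curvature X) t u =
  (4 * l t ^ 2 * u * w t * D t u + 2 * F t * N t u) / (D t u ^ 3 * sqrt (D t u))
    / (w t * sqrt (D t u))).
{ rewrite <- HB, <- Hsq by auto. field. rewrite Hsq by auto. nra. }
rewrite HA0, HB0 in HR.
destruct (HX t u Ht Hu) as (_ & HE & HF & HG & HK).
rewrite HE, HF, HG, HK in HR.
clear HA0 HB0 HA1 HB1 HE HF HG HK HX HA HB HK1 HK2 Hdet Hsq.
match goal with |- ?P = 0 =>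
  assert (HP : 2 * l t ^ 4 * P = w t * D t u ^ 7 * 0) end.
{ rewrite <- HR. change (l t ^ 2 + u ^ 2) with (D t u).
  set (S := sqrt (D t u)) in *.
  unfold N, p, p1, q, q1, D in *.
  assert (HS2 : S ^ 2 = l t ^ 2 + u ^ 2) by (rewrite <- HSS; ring).
  field [HS2]. repeat split; lra. }
rewrite Rmult_0_r in HP.
assert (Hl4 : 2 * l t ^ 4 <> 0) by (apply Rmult_integral_contrapositive; split; [lra|apply pow_nonzero, Hl]).
apply Rmult_integral in HP; destruct HP as [HP|HP]; [contradiction|exact HP].
Qed.

(** The coefficients of degree 4, 2 and 0 of the quartic give in turn p' = 0,
4 q^2 = 5 p^2 l^2 and p^2 l^2 = 2 q^2, hence p = q = 0.  Where [l] vanishes the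
Ricci condition is empty, but l l' = 0 holds there trivially; so l^2 is
constant on the whole interval, and a single nonzero value suffices. *)
Lemma ricci_rigid I J X (l l1 l2 F F1 w w1 : R -> R) :
  open_interval I -> open_interval J ->
  (forall t, I t -> is_derive l t (l1 t) /\ is_derive l1 t (l2 t) /\
     is_derive F t (F1 t) /\ is_derive w t (w1 t) /\ 0 < w t) ->
  (forall t u, I t -> J u -> 0 < l t ^ 2 + u ^ 2 /\
     fffE X t u = F t ^ 2 + w t ^ 2 * (l t ^ 2 + u ^ 2) /\
     fffF X t u = F t /\ fffG X t u = 1 /\
     gauss_curvature X t u = - l t ^ 2 / (l t ^ 2 + u ^ 2) ^ 2) ->
  ricci_condition I J X ->
  (exists t, I t /\ l t <> 0) ->
  exists c, c <> 0 /\ forall t, I t -> l t = c /\ F t = 0.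
Proof.
intros HI HJ Hd HX HR [t0 [Ht0 Hl0]].
assert (Hloc : forall t, I t -> l t <> 0 -> l1 t = 0 /\ F t = 0).
{ intros t Ht Hl.
  assert (HP := ricci_quartic I J X l l1 l2 F F1 w w1 HI HJ Hd HX HR t Ht Hl).
  destruct (Hd t Ht) as (_ & _ & _ & _ & Hw).
  cbv zeta in HP; revert HP.
  set (p := l1 t / (l t * w t)).
  set (p1 := (l2 t * (l t * w t) - l1 t * (l1 t * w t + l t * w1 t)) / (l t * w t) ^ 2).
  set (q := F t / w t).
  set (q1 := (F1 t * w t - F t * w1 t) / w t ^ 2).
  intros HP.
  destruct (quartic_vanishing J
    ((- p1 * l t ^ 2 - 2 * w t * p ^ 2 * l t ^ 2 - 2 * w t * q ^ 2) * l t ^ 2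
       + 3 * w t * p ^ 2 * l t ^ 4)
    ((2 * q1 - 2 * w t * p * q) * l t ^ 2 - 9 * w t * p * q * l t ^ 2)
    (w t * (4 * q ^ 2 - 5 * p ^ 2 * l t ^ 2))
    (2 * q1 + w t * p * q) p1 HJ) as (H0 & _ & H2 & _ & H4).
  { intros u Hu; rewrite <- (HP u Hu); ring. }
  rewrite H4 in H0.
  assert (Hl2 : 0 < l t ^ 2) by (apply pow2_gt_0, Hl).
  assert (H2' : 4 * q ^ 2 - 5 * p ^ 2 * l t ^ 2 = 0).
  { apply Rmult_integral in H2; destruct H2; [lra|assumption]. }
  assert (H0' : p ^ 2 * l t ^ 2 - 2 * q ^ 2 = 0).
  { assert (E : w t * l t ^ 2 * (p ^ 2 * l t ^ 2 - 2 * q ^ 2) = 0) by (rewrite <- H0; ring).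
    apply Rmult_integral in E; destruct E as [E|E]; [|exact E].
    assert (0 < w t * l t ^ 2) by (apply Rmult_lt_0_compat; assumption); lra. }
  assert (Hq : q = 0) by nra.
  assert (Hp : p ^ 2 * l t ^ 2 = 0) by (rewrite Hq in H0'; lra).
  apply Rmult_integral in Hp; destruct Hp as [Hp|Hp]; [|lra].
  assert (Hp' : p = 0) by nra.
  split.
  - replace (l1 t) with (p * (l t * w t)) by (unfold p; field; lra). rewrite Hp'; ring.
  - replace (F t) with (q * w t) by (unfold q; field; lra). rewrite Hq; ring. }
assert (Hsq : forall t, I t -> l t * l t = l t0 * l t0).
{ intros t Ht; apply (derive_zero_constant I (fun s => l s * l s)); auto.
  intros s Hs; destruct (Hd s Hs) as (Hs1 & _).
  eapply is_derive_eq; [apply is_derive_Rmult; exact Hs1|].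
  destruct (Req_dec (l s) 0) as [E|E]; [rewrite E; ring|].
  destruct (Hloc s Hs E) as [-> _]; ring. }
assert (Hnz : forall t, I t -> l t <> 0).
{ intros t Ht E; specialize (Hsq t Ht); rewrite E in Hsq; apply Hl0; nra. }
exists (l t0); split; [exact Hl0|].
intros t Ht; split; [|apply (Hloc t Ht), Hnz, Ht].
apply (derive_zero_constant I l); auto.
intros s Hs; destruct (Hd s Hs) as (Hs1 & _).
destruct (Hloc s Hs (Hnz s Hs)) as [<- _]; exact Hs1.
Qed.

(** * Geometry of a ruled surface along its line of striction *)

Definition striction_line (I : R -> Prop) (a b : R -> vec3) : Prop :=
  forall t, I t -> dot (b t) (b t) = 1 /\ dot (vderive a t) (vderive b t) = 0 /\
    0 < dot (vderive b t) (vderive b t).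

Lemma has_deriv_comp c (h : R -> R) s d : has_deriv c (h s) d -> ex_derive h s ->
  has_deriv (fun r => c (h r)) s (vscal (Derive h s) d).
Proof.
intros (H1 & H2 & H3) Hh; apply Derive_correct in Hh.
split; [|split];
 (eapply is_derive_eq;
  [apply (is_derive_comp (fun x => _ (c x)) h); eassumption | reflexivity]).
Qed.

(** The chain rule multiplies both derivatives by the derivative of the
normalizing reparametrization, which is nonzero. *)
Lemma ruled_surface_striction_line I J a b : ruled_surface I J a b -> striction_line I a b.
Proof.
intros (HI & HJ & Ha & Hb & _ & I0 & h & HI0 & (Hh & Hreg & Hsur) & Hn) t Ht.
destruct (Hsur t Ht) as (s & Hs & <-).
destruct (Hreg s Hs) as [_ Hh'].
destruct (Hn s Hs) as (H1 & H2 & H3).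
assert (Hex := Hh 1%nat s Hs : ex_derive h s).
rewrite (has_deriv_unique _ _ _ (has_deriv_comp a h s _ (vsmooth_has_deriv I a _ Ha Ht) Hex)) in H3.
rewrite (has_deriv_unique _ _ _ (has_deriv_comp b h s _ (vsmooth_has_deriv I b _ Hb Ht) Hex)) in H2, H3.
set (k := Derive h s) in *.
apply dot_unit in H1; apply dot_unit in H2.
split; [exact H1|split].
- assert (E : k * k * dot (vderive a (h s)) (vderive b (h s)) = 0) by (rewrite <- H3; vec_ring).
  apply Rmult_integral in E; destruct E as [E|E]; [|exact E].
  apply Rmult_integral in E; tauto.
- destruct (dot_nonneg (vderive b (h s))) as [E|E]; [exact E|].
  assert (E2 : k * k * dot (vderive b (h s)) (vderive b (h s)) = 1) by (rewrite <- H2; vec_ring).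
  rewrite <- E in E2; lra.
Qed.

Lemma V1_ruled I a b t u : vsmooth_on I a -> vsmooth_on I b -> I t ->
  V1 (ruled a b) t u = vadd (vderive a t) (vscal u (vderive b t)).
Proof.
intros Ha Hb Ht; apply has_deriv_unique; unfold ruled.
eapply has_deriv_eq.
- apply has_deriv_add; [|apply has_deriv_scal; [apply is_derive_Rconst|]];
  apply (vsmooth_has_deriv I); assumption.
- vec_ring.
Qed.

Lemma has_deriv_line p q u : has_deriv (fun v => vadd p (vscal v q)) u q.
Proof.
split; [|split]; unfold vadd, vscal, cx, cy, cz; simpl; auto_derive; auto; ring.
Qed.

Lemma V2_ruled a b t u : V2 (ruled a b) t u = b t.
Proof. apply has_deriv_unique, has_deriv_line. Qed.

Lemma V11_ruled I a b t u : open_interval I -> vsmooth_on I a -> vsmooth_on I b -> I t ->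
  V1 (V1 (ruled a b)) t u = vadd (vderive (vderive a) t) (vscal u (vderive (vderive b) t)).
Proof.
intros HI Ha Hb Ht; apply has_deriv_unique.
eapply has_deriv_ext_loc with (c := fun s => vadd (vderive a s) (vscal u (vderive b s))).
- apply (locally_on I); auto; intros s Hs; symmetry; eapply V1_ruled; eassumption.
- eapply has_deriv_eq.
  + apply has_deriv_add; [|apply has_deriv_scal; [apply is_derive_Rconst|]];
      apply (vsmooth_has_deriv I); try apply vsmooth_vderive; assumption.
  + vec_ring.
Qed.

Lemma V21_ruled I a b t u : vsmooth_on I a -> vsmooth_on I b -> I t ->
  V2 (V1 (ruled a b)) t u = vderive b t.
Proof.
intros Ha Hb Ht; apply has_deriv_unique.
eapply has_deriv_ext_loc; [|apply has_deriv_line with (p := vderive a t)].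
apply filter_forall; intros v; symmetry; eapply V1_ruled; eassumption.
Qed.

Lemma V22_ruled a b t u : V2 (V2 (ruled a b)) t u = vzero.
Proof.
apply has_deriv_unique.
eapply has_deriv_ext_loc; [|apply has_deriv_const with (p := b t)].
apply filter_forall; intros v; symmetry; apply V2_ruled.
Qed.

(** The amount of regularity of the distribution parameter, a quotient, which
the Laplacian of the curvature calls for. *)
Definition twice_derivable (I : R -> Prop) (f : R -> R) : Prop :=
  exists f1 f2 : R -> R, forall t, I t -> is_derive f t (f1 t) /\ is_derive f1 t (f2 t).

Lemma twice_derivable_smooth I f : smooth_on I f -> twice_derivable I f.
Proof.
intros H; exists (Derive f), (Derive (Derive f)); intros t Ht; split.
- eapply smooth_is_derive; eassumption.
- eapply smooth_is_derive; [apply smooth_Derive|]; eassumption.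
Qed.

Lemma twice_derivable_plus I f g : twice_derivable I f -> twice_derivable I g ->
  twice_derivable I (fun t => f t + g t).
Proof.
intros (f1 & f2 & Hf) (g1 & g2 & Hg).
exists (fun t => f1 t + g1 t), (fun t => f2 t + g2 t); intros t Ht.
destruct (Hf t Ht), (Hg t Ht); split; apply is_derive_Rplus; assumption.
Qed.

Lemma twice_derivable_minus I f g : twice_derivable I f -> twice_derivable I g ->
  twice_derivable I (fun t => f t - g t).
Proof.
intros (f1 & f2 & Hf) (g1 & g2 & Hg).
exists (fun t => f1 t - g1 t), (fun t => f2 t - g2 t); intros t Ht.
destruct (Hf t Ht), (Hg t Ht); split; apply is_derive_Rminus; assumption.
Qed.

Lemma twice_derivable_mult I f g : twice_derivable I f -> twice_derivable I g ->
  twice_derivable I (fun t => f t * g t).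
Proof.
intros (f1 & f2 & Hf) (g1 & g2 & Hg).
exists (fun t => f1 t * g t + f t * g1 t),
  (fun t => f2 t * g t + f1 t * g1 t + (f1 t * g1 t + f t * g2 t)); intros t Ht.
destruct (Hf t Ht), (Hg t Ht); split; [|apply is_derive_Rplus];
  apply is_derive_Rmult; assumption.
Qed.

Lemma twice_derivable_inv I f : (forall t, I t -> f t <> 0) -> twice_derivable I f ->
  twice_derivable I (fun t => / f t).
Proof.
intros Hnz (f1 & f2 & Hf).
exists (fun t => - f1 t / f t ^ 2), (fun t => (2 * f1 t ^ 2 - f t * f2 t) / f t ^ 3).
intros t Ht; destruct (Hf t Ht) as [H1 H2]; specialize (Hnz t Ht); split.
- apply is_derive_inv; assumption.
- auto_derive.
  + repeat split; try (eexists; eassumption).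
    rewrite Rmult_1_r; apply Rmult_integral_contrapositive; split; assumption.
  + rewrite (is_derive_unique (fun x : R => f x) _ _ H1),
      (is_derive_unique (fun x : R => f1 x) _ _ H2); field; assumption.
Qed.

Lemma twice_derivable_dot I p q : vsmooth_on I p -> vsmooth_on I q ->
  twice_derivable I (fun t => dot (p t) (q t)).
Proof.
intros (H1 & H2 & H3) (K1 & K2 & K3); unfold dot.
apply twice_derivable_plus; [apply twice_derivable_plus|]; apply twice_derivable_mult;
  apply twice_derivable_smooth; assumption.
Qed.

Lemma twice_derivable_triple I p q r : vsmooth_on I p -> vsmooth_on I q -> vsmooth_on I r ->
  twice_derivable I (fun t => dot (cross (p t) (q t)) (r t)).
Proof.
intros (H1 & H2 & H3) (K1 & K2 & K3) (L1 & L2 & L3).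
change (twice_derivable I (fun t =>
  (cy (p t) * cz (q t) - cz (p t) * cy (q t)) * cx (r t)
  + (cz (p t) * cx (q t) - cx (p t) * cz (q t)) * cy (r t)
  + (cx (p t) * cy (q t) - cy (p t) * cx (q t)) * cz (r t))).
apply twice_derivable_plus; [apply twice_derivable_plus|];
  (apply twice_derivable_mult; [apply twice_derivable_minus; apply twice_derivable_mult|]);
  apply twice_derivable_smooth; assumption.
Qed.

Lemma striction_orthogonal I a b : open_interval I -> vsmooth_on I b -> striction_line I a b ->
  forall t, I t -> dot (b t) (vderive b t) = 0.
Proof.
intros HI Hb Hs t Ht.
assert (Hd := vsmooth_has_deriv I b t Hb Ht).
assert (E := zero_on_derive I (fun s => dot (b s) (b s) - 1) HI).
specialize (E (fun s Hs' => ltac:(cbv beta; rewrite (proj1 (Hs s Hs')); ring)) t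
  (dot (vderive b t) (b t) + dot (b t) (vderive b t) - 0) Ht).
assert (E2 : dot (vderive b t) (b t) + dot (b t) (vderive b t) - 0 = 0).
{ apply E, is_derive_Rminus; [apply has_deriv_dot; assumption|apply is_derive_Rconst]. }
rewrite (dot_sym (vderive b t)) in E2; lra.
Qed.

Lemma fffdet_cross X t u :
  fffdet X t u = dot (cross (V1 X t u) (V2 X t u)) (cross (V1 X t u) (V2 X t u)).
Proof. rewrite lagrange_identity; reflexivity. Qed.

(** An explicit formula for the distribution parameter, from which its
differentiability can be read off. *)
Definition distribution (a b : R -> vec3) (t : R) : R :=
  dot (cross (vderive a t) (b t)) (vderive b t) / dot (vderive b t) (vderive b t).

(** The striction line is recovered from its two components along the ruling
and along the common perpendicular of neighbouring rulings. *)
Lemma striction_velocity I a b lambda t : open_interval I -> vsmooth_on I b ->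
  striction_line I a b ->
  distribution_parameter I a b lambda -> I t ->
  vderive a t = vadd (vscal (dot (vderive a t) (b t)) (b t))
                     (vscal (lambda t) (cross (b t) (vderive b t))).
Proof.
intros HI Hb Hs Hl Ht.
destruct (Hs t Ht) as (H1 & _ & _).
assert (E := cross_cross (b t) (vderive a t) (b t)).
rewrite (Hl t Ht), H1 in E.
assert (E2 : vderive a t = vadd (vscal (dot (vderive a t) (b t)) (b t))
  (vsub (vscal 1 (vderive a t)) (vscal (dot (b t) (vderive a t)) (b t)))).
{ rewrite (dot_sym (b t)); vec_ring. }
rewrite <- E in E2; rewrite E2 at 1; f_equal; vec_ring.
Qed.

Lemma distribution_parameter_eq I a b lambda t : striction_line I a b ->
  distribution_parameter I a b lambda -> I t -> lambda t = distribution a b t.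
Proof.
intros Hs Hl Ht; destruct (Hs t Ht) as (_ & _ & H).
unfold distribution; rewrite (Hl t Ht).
replace (dot (vscal (lambda t) (vderive b t)) (vderive b t))
  with (lambda t * dot (vderive b t) (vderive b t)) by vec_ring.
field; lra.
Qed.

Lemma ruled_metric I a b lambda t u : open_interval I -> vsmooth_on I a -> vsmooth_on I b ->
  striction_line I a b -> distribution_parameter I a b lambda -> I t ->
  let X := ruled a b in
  fffE X t u = dot (vderive a t) (b t) ^ 2 + vnorm (vderive b t) ^ 2 * (lambda t ^ 2 + u ^ 2) /\
  fffF X t u = dot (vderive a t) (b t) /\ fffG X t u = 1.
Proof.
intros HI Ha Hb Hs Hl Ht X; unfold X, fffE, fffF, fffG.
rewrite V2_ruled, (V1_ruled I) by assumption.
assert (Hv := striction_velocity I a b lambda t HI Hb Hs Hl Ht).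
assert (H0 := striction_orthogonal I a b HI Hb Hs t Ht).
destruct (Hs t Ht) as (H1 & H2 & H3).
replace (vnorm (vderive b t) ^ 2) with (dot (vderive b t) (vderive b t))
  by (rewrite <- vnorm_sq; ring).
assert (Haa : dot (vderive a t) (vderive a t)
  = dot (vderive a t) (b t) ^ 2 + dot (vderive b t) (vderive b t) * lambda t ^ 2).
{ set (f := dot (vderive a t) (b t)) in *. rewrite Hv.
  set (n := cross (b t) (vderive b t)).
  transitivity (f ^ 2 * dot (b t) (b t) + 2 * f * lambda t * dot n (b t) + lambda t ^ 2 * dot n n);
    [vec_ring|].
  unfold n; rewrite lagrange_identity, H0, H1.
  replace (dot (cross (b t) (vderive b t)) (b t)) with 0 by vec_ring.
  ring. }
repeat split.
- transitivity (dot (vderive a t) (vderive a t) + 2 * u * dot (vderive a t) (vderive b t)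
    + u ^ 2 * dot (vderive b t) (vderive b t)); [vec_ring|].
  rewrite Haa, H2; ring.
- transitivity (dot (vderive a t) (b t) + u * dot (b t) (vderive b t)); [vec_ring|].
  rewrite H0; ring.
- exact H1.
Qed.

Lemma ruled_fffdet I a b lambda t u : open_interval I -> vsmooth_on I a -> vsmooth_on I b ->
  striction_line I a b -> distribution_parameter I a b lambda -> I t ->
  fffdet (ruled a b) t u = vnorm (vderive b t) ^ 2 * (lambda t ^ 2 + u ^ 2).
Proof.
intros HI Ha Hb Hs Hl Ht; unfold fffdet.
destruct (ruled_metric I a b lambda t u HI Ha Hb Hs Hl Ht) as (-> & -> & ->); ring.
Qed.

(** The coefficient <X_uu, N> is zero, so K = - M^2 / (E G - F^2), and M comes
from <b', a' x b> = lambda |b'|^2. *)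
Lemma ruled_gauss_curvature I a b lambda t u : open_interval I ->
  vsmooth_on I a -> vsmooth_on I b ->
  striction_line I a b -> distribution_parameter I a b lambda -> I t ->
  0 < lambda t ^ 2 + u ^ 2 ->
  gauss_curvature (ruled a b) t u = - lambda t ^ 2 / (lambda t ^ 2 + u ^ 2) ^ 2.
Proof.
intros HI Ha Hb Hs Hl Ht HD.
destruct (Hs t Ht) as (H1 & H2 & H3).
unfold gauss_curvature, sffL, sffM, sffN.
rewrite V22_ruled, (V21_ruled I) by assumption.
assert (Hw : 0 < vnorm (vderive b t)) by (apply sqrt_lt_R0, H3).
assert (HdetE := ruled_fffdet I a b lambda t u HI Ha Hb Hs Hl Ht).
unfold unit_normal.
set (k := / vnorm _).
assert (Hk : k ^ 2 = / fffdet (ruled a b) t u).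
{ unfold k; rewrite fffdet_cross, <- vnorm_sq, Rinv_mult; ring. }
set (n := cross (V1 _ _ _) _) in *.
assert (HM : dot (vderive b t) n = lambda t * vnorm (vderive b t) ^ 2).
{ unfold n; rewrite V2_ruled, (V1_ruled I) by assumption.
  transitivity (dot (vderive b t) (cross (vderive a t) (b t))); [vec_ring|].
  rewrite (Hl t Ht); replace (vnorm (vderive b t) ^ 2) with (dot (vderive b t) (vderive b t))
    by (rewrite <- vnorm_sq; ring); vec_ring. }
transitivity (- (k ^ 2 * dot (vderive b t) n ^ 2) / fffdet (ruled a b) t u).
{ f_equal; vec_ring. }
rewrite Hk, HM, HdetE; field; lra.
Qed.

(** The rigidity of non-developable ruled Ricci surfaces: the distribution
parameter is constant and the line of striction is orthogonal to the rulings. *)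
Lemma ricci_striction I J a b : non_developable_ruled_ricci I J a b ->
  exists c, c <> 0 /\
    forall t, I t -> vderive a t = vscal c (cross (b t) (vderive b t)).
Proof.
intros (Hr & (lambda & Hl & t0 & Ht0 & Hl0) & HR).
assert (Hs := ruled_surface_striction_line I J a b Hr).
destruct Hr as (HI & HJ & Ha & Hb & Himm & _).
assert (Ha' := vsmooth_vderive I a Ha).
assert (Hb' := vsmooth_vderive I b Hb).
assert (HlE : forall t, I t -> lambda t = distribution a b t)
  by (intros; eapply distribution_parameter_eq; eassumption).
assert (Hd : distribution_parameter I a b (distribution a b)).
{ intros t Ht; rewrite <- HlE by assumption; apply Hl, Ht. }
assert (HC2 : twice_derivable I (distribution a b)).
{ apply twice_derivable_mult; [apply twice_derivable_triple; assumption|].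
  apply twice_derivable_inv; [intros t Ht; apply Rgt_not_eq, Hs, Ht|].
  apply twice_derivable_dot; assumption. }
destruct HC2 as (l1 & l2 & Hl12).
destruct (ricci_rigid I J (ruled a b) (distribution a b) l1 l2
  (fun t => dot (vderive a t) (b t))
  (fun t => dot (vderive (vderive a) t) (b t) + dot (vderive a t) (vderive b t))
  (fun t => vnorm (vderive b t))
  (fun t => dot (vderive (vderive b) t) (vderive b t) / vnorm (vderive b t)) HI HJ)
  as (c & Hc & Hrig).
- intros t Ht.
  destruct (Hs t Ht) as (_ & _ & Hw).
  destruct (Hl12 t Ht) as [Hd1 Hd2]; split; [exact Hd1|split; [exact Hd2|split; [|split]]].
  + apply has_deriv_dot; apply (vsmooth_has_deriv I); assumption.
  + assert (HW : is_derive (fun s => dot (vderive b s) (vderive b s)) t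
      (2 * dot (vderive (vderive b) t) (vderive b t))).
    { eapply is_derive_eq;
      [apply has_deriv_dot; apply (vsmooth_has_deriv I); assumption|].
      rewrite (dot_sym (vderive b t)); ring. }
    unfold vnorm. eapply is_derive_eq.
    * apply (is_derive_comp sqrt (fun s => dot (vderive b s) (vderive b s)));
        [apply is_derive_Reals, derivable_pt_lim_sqrt, Hw|exact HW].
    * change (@eq R (2 * dot (vderive (vderive b) t) (vderive b t)
         * / (2 * sqrt (dot (vderive b t) (vderive b t))))
         (dot (vderive (vderive b) t) (vderive b t) / sqrt (dot (vderive b t) (vderive b t)))).
      field; apply Rgt_not_eq, sqrt_lt_R0, Hw.
  + apply sqrt_lt_R0, Hw.
- intros t u Ht Hu.
  assert (HD : 0 < distribution a b t ^ 2 + u ^ 2).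
  { destruct (Hs t Ht) as (_ & _ & Hw).
    assert (E := dot_self_pos _ (Himm t u Ht Hu)).
    rewrite <- fffdet_cross, (ruled_fffdet I a b (distribution a b)) in E by assumption.
    replace (vnorm (vderive b t) ^ 2) with (dot (vderive b t) (vderive b t)) in E
      by (rewrite <- vnorm_sq; ring).
    nra. }
  destruct (ruled_metric I a b (distribution a b) t u HI Ha Hb Hs Hd Ht) as (E1 & E2 & E3).
  repeat (split; [assumption|]).
  apply (ruled_gauss_curvature I); assumption.
- exact HR.
- exists t0; split; [exact Ht0|rewrite <- HlE; assumption].
- exists c; split; [exact Hc|].
  intros t Ht; destruct (Hrig t Ht) as [E1 E2].
  rewrite (striction_velocity I a b (distribution a b) t HI Hb Hs Hd Ht) at 1.
  rewrite E1, E2; vec_ring.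
Qed.

(** * Mean curvature *)

(** det (b, b', b''): it vanishes exactly when the spherical curve [b] has zero
geodesic curvature, i.e. runs in a great circle. *)
Definition director_triple (b : R -> vec3) (t : R) : R :=
  dot (cross (b t) (vderive b t)) (vderive (vderive b) t).

Lemma second_derivative_striction I a b c t : open_interval I ->
  vsmooth_on I a -> vsmooth_on I b ->
  (forall t, I t -> vderive a t = vscal c (cross (b t) (vderive b t))) -> I t ->
  vderive (vderive a) t = vscal c (cross (b t) (vderive (vderive b) t)).
Proof.
intros HI Ha Hb Hv Ht; apply has_deriv_unique.
eapply has_deriv_ext_loc with (c := fun s => vscal c (cross (b s) (vderive b s))).
- apply (locally_on I); auto; intros s Hs; symmetry; auto.
- eapply has_deriv_eq.
  + assert (Hb' := vsmooth_vderive I b Hb).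
    exact (has_deriv_scal _ _ _ _ _ (is_derive_Rconst c t)
      (has_deriv_cross _ _ _ _ _ (vsmooth_has_deriv I b t Hb Ht)
         (vsmooth_has_deriv I _ t Hb' Ht))).
  + vec_ring.
Qed.

(** Because F = 0 and <X_uu, N> = 0, H = <X_tt, N> / (2 E).  With
a' = c (b x b'), the mixed terms c u of <X_tt, X_t x X_u> cancel and
- (c^2 + u^2) det (b, b', b'') remains. *)
Lemma ruled_mean_curvature I a b c t u : open_interval I ->
  vsmooth_on I a -> vsmooth_on I b -> striction_line I a b -> c <> 0 ->
  (forall t, I t -> vderive a t = vscal c (cross (b t) (vderive b t))) -> I t ->
  mean_curvature (ruled a b) t u =
  - director_triple b t / (2 * vnorm (vderive b t) ^ 3 * sqrt (c ^ 2 + u ^ 2)).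
Proof.
intros HI Ha Hb Hs Hc Hv Ht.
destruct (Hs t Ht) as (H1 & _ & H3).
assert (H0 := striction_orthogonal I a b HI Hb Hs t Ht).
assert (Hl : distribution_parameter I a b (fun _ => c)).
{ intros s Hs'; rewrite (Hv s Hs').
  assert (H1s := proj1 (Hs s Hs')).
  assert (H0s := striction_orthogonal I a b HI Hb Hs s Hs').
  transitivity (vscal c (vsub (vscal (dot (b s) (b s)) (vderive b s))
     (vscal (dot (b s) (vderive b s)) (b s)))); [vec_ring|].
  rewrite H1s, H0s; vec_ring. }
assert (HD : 0 < c ^ 2 + u ^ 2) by nra.
assert (Hw : 0 < vnorm (vderive b t)) by (apply sqrt_lt_R0, H3).
assert (HdetE := ruled_fffdet I a b (fun _ => c) t u HI Ha Hb Hs Hl Ht).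
destruct (ruled_metric I a b (fun _ => c) t u HI Ha Hb Hs Hl Ht) as (_ & HF & HG).
replace (dot (vderive a t) (b t)) with 0 in HF by (rewrite (Hv t Ht); vec_ring).
cbv beta in *.
unfold mean_curvature; rewrite HF, HG, HdetE; unfold sffN; rewrite V22_ruled.
unfold sffL, unit_normal.
assert (Hk : vnorm (cross (V1 (ruled a b) t u) (V2 (ruled a b) t u))
   = vnorm (vderive b t) * sqrt (c ^ 2 + u ^ 2)).
{ unfold vnorm at 1; rewrite <- fffdet_cross, HdetE.
  rewrite sqrt_mult; [|nra|lra]. rewrite sqrt_pow2 by lra; reflexivity. }
rewrite Hk.
rewrite (V11_ruled I), (V1_ruled I), V2_ruled by assumption.
rewrite (second_derivative_striction I a b c t HI Ha Hb Hv Ht), (Hv t Ht).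
assert (HL : dot (vadd (vscal c (cross (b t) (vderive (vderive b) t)))
                       (vscal u (vderive (vderive b) t)))
   (cross (vadd (vscal c (cross (b t) (vderive b t))) (vscal u (vderive b t))) (b t))
   = - (c ^ 2 + u ^ 2) * director_triple b t).
{ transitivity (- (c ^ 2 * dot (b t) (b t) + u ^ 2) * director_triple b t);
    [unfold director_triple; vec_ring|rewrite H1; ring]. }
assert (HS := sqrt_lt_R0 _ HD).
assert (HSS := sqrt_sqrt _ (Rlt_le _ _ HD)).
set (S := sqrt (c ^ 2 + u ^ 2)) in *.
set (k := / (vnorm (vderive b t) * S)).
match type of HL with dot ?p ?q = _ =>
  replace (dot p (vscal k q)) with (k * dot p q) by vec_ring end.
match goal with |- context [dot vzero ?q] => replace (dot vzero q) with 0 by vec_ring end.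
rewrite HL; unfold k; rewrite <- HSS; field; lra.
Qed.

(** * A great circle of directions generates a helicoid *)

Lemma vderive_zero_constant I p : open_interval I -> (forall t, I t -> has_deriv p t vzero) ->
  forall s t, I s -> I t -> p s = p t.
Proof.
intros HI Hp s t Hs Ht.
apply vec_ext; [apply (derive_zero_constant I (fun r => cx (p r)))
  |apply (derive_zero_constant I (fun r => cy (p r)))
  |apply (derive_zero_constant I (fun r => cz (p r)))]; auto; intros r Hr; apply (Hp r Hr).
Qed.

(** The endpoints are the infimum and the supremum in the extended reals. *)
Lemma convex_open_interval (S : R -> Prop) : (exists s, S s) ->
  (forall x y s, S x -> S y -> x < s < y -> S s) ->
  (forall s, S s -> exists x y, S x /\ S y /\ x < s < y) ->
  open_interval S.
Proof.
intros [s0 Hs0] Hconv Hopen.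
destruct (Glb_Rbar_correct S) as [Hlb Hglb].
destruct (Lub_Rbar_correct S) as [Hub Hlub].
assert (Hin : forall s, S s -> Rbar_lt (Glb_Rbar S) s /\ Rbar_lt s (Lub_Rbar S)).
{ intros s Hs; destruct (Hopen s Hs) as (x & y & Hx & Hy & Hxs & Hsy); split.
  - eapply Rbar_le_lt_trans; [apply Hlb, Hx|exact Hxs].
  - eapply Rbar_lt_le_trans; [|apply Hub, Hy]; exact Hsy. }
exists (Glb_Rbar S), (Lub_Rbar S); split.
- eapply Rbar_lt_trans; apply Hin, Hs0.
- intros s; split; [apply Hin|intros [H1 H2]].
  destruct (Classical_Prop.classic (exists x, S x /\ x < s)) as [(x & Hx & Hxs)|N1].
  2: { elim (Rbar_le_not_lt _ _ (Hglb s (fun x Hx => Rnot_lt_le _ _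
         (fun Hxs => N1 (ex_intro _ x (conj Hx Hxs))))) H1). }
  destruct (Classical_Prop.classic (exists y, S y /\ s < y)) as [(y & Hy & Hsy)|N2].
  2: { elim (Rbar_le_not_lt _ _ (Hlub s (fun x Hx => Rnot_lt_le _ _
         (fun Hxs => N2 (ex_intro _ x (conj Hx Hxs))))) H2). }
  apply (Hconv x y s); auto.
Qed.

Lemma image_open_interval I (f df : R -> R) : open_interval I ->
  (forall t, I t -> is_derive f t (df t) /\ 0 < df t) ->
  open_interval (fun s => exists t, I t /\ f t = s).
Proof.
intros HI Hf.
assert (Hinc : forall x y, I x -> I y -> x < y -> f x < f y).
{ intros x y Hx Hy Hxy.
  assert (Hin : forall t, x <= t <= y -> I t)
    by (intros t Ht; apply (open_interval_between I x y); auto).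
  destruct (MVT_gen f x y df) as (z & Hz & E).
  - rewrite Rmin_left, Rmax_right by lra; intros t Ht; apply Hf, Hin; lra.
  - rewrite Rmin_left, Rmax_right by lra; intros t Ht.
    apply derivable_continuous_pt; exists (df t); apply is_derive_Reals, Hf, Hin, Ht.
  - rewrite Rmin_left, Rmax_right in Hz by lra.
    destruct (Hf z (Hin z Hz)) as [_ Hpos]; nra. }
apply convex_open_interval.
- destruct (open_interval_inhabited I HI) as [t Ht]; exists (f t), t; auto.
- intros x y s (tx & Hx & <-) (ty & Hy & <-) Hs.
  destruct (Rlt_le_dec tx ty) as [Hlt|Hle].
  2: { destruct Hle as [Hlt|E]; [assert (H := Hinc _ _ Hy Hx Hlt); lra|subst; lra]. }
  assert (Hc : forall t, I t -> continuity_pt f t).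
  { intros t Ht; apply derivable_continuous_pt; exists (df t); apply is_derive_Reals, Hf, Ht. }
  assert (Hlim : forall t, I t -> is_lim f t (f t)).
  { intros t Ht; apply is_lim_continuity, Hc, Ht. }
  destruct (IVT_Rbar_incr f tx ty (f tx) (f ty) s (Hlim tx Hx) (Hlim ty Hy))
    as (z & Hz1 & Hz2 & Hz).
  + intros t H1 H2; apply Hc, (open_interval_between I tx ty); auto; simpl in *; lra.
  + exact Hlt.
  + simpl; lra.
  + exists z; split; [|exact Hz].
    apply (open_interval_between I tx ty); auto; simpl in *; lra.
- intros s (t & Ht & <-).
  destruct (open_interval_locally I t HI Ht) as [eps Heps].
  assert (He := cond_pos eps).
  assert (H1 : I (t - eps / 2)).
  { apply Heps; unfold ball; simpl; unfold AbsRing_ball, abs, minus, plus, opp; simpl.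
    apply Rabs_def1; lra. }
  assert (H2 : I (t + eps / 2)).
  { apply Heps; unfold ball; simpl; unfold AbsRing_ball, abs, minus, plus, opp; simpl.
    apply Rabs_def1; lra. }
  exists (f (t - eps / 2)), (f (t + eps / 2)).
  split; [eexists; eauto|split; [eexists; eauto|split; apply Hinc; auto; lra]].
Qed.

Lemma isometry_orthonormal_frame o e1 e2 e3 :
  dot e1 e1 = 1 -> dot e2 e2 = 1 -> dot e3 e3 = 1 ->
  dot e1 e2 = 0 -> dot e1 e3 = 0 -> dot e2 e3 = 0 ->
  isometry (fun p => vadd o (vadd (vscal (cx p) e1) (vadd (vscal (cy p) e2) (vscal (cz p) e3)))).
Proof.
intros H1 H2 H3 H12 H13 H23 p q; unfold vnorm; f_equal.
set (x := cx p - cx q); set (y := cy p - cy q); set (z := cz p - cz q).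
transitivity (x ^ 2 * dot e1 e1 + y ^ 2 * dot e2 e2 + z ^ 2 * dot e3 e3
  + 2 * x * y * dot e1 e2 + 2 * x * z * dot e1 e3 + 2 * y * z * dot e2 e3).
- unfold x, y, z; vec_ring.
- rewrite H1, H2, H3, H12, H13, H23; unfold x, y, z; vec_ring.
Qed.

(** The axis is the unit vector along b x b'.  It is constant: its derivative is
orthogonal to it, and is parallel to it because b'' lies in the span of b and
b'. *)
Lemma planar_director_axis I b : open_interval I -> vsmooth_on I b ->
  (forall t, I t -> dot (b t) (b t) = 1 /\ dot (b t) (vderive b t) = 0 /\
     0 < dot (vderive b t) (vderive b t) /\ director_triple b t = 0) ->
  exists e, dot e e = 1 /\ forall t, I t ->
    cross (b t) (vderive b t) = vscal (vnorm (vderive b t)) e.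
Proof.
intros HI Hb Hp.
assert (Hb' := vsmooth_vderive I b Hb).
set (n := fun t => cross (b t) (vderive b t)).
set (W := fun t => dot (vderive b t) (vderive b t)).
assert (Hn : forall t, I t -> has_deriv n t (cross (b t) (vderive (vderive b) t))).
{ intros t Ht; eapply has_deriv_eq;
  [exact (has_deriv_cross _ _ _ _ _ (vsmooth_has_deriv I b t Hb Ht)
         (vsmooth_has_deriv I _ t Hb' Ht))|vec_ring]. }
assert (HW : forall t, I t -> is_derive (fun s => / sqrt (W s)) t
   (- dot (vderive b t) (vderive (vderive b) t) / (W t * sqrt (W t)))).
{ intros t Ht; destruct (Hp t Ht) as (_ & _ & HWt & _); fold (W t) in HWt.
  assert (Hd := has_deriv_dot _ _ _ _ _ (vsmooth_has_deriv I _ t Hb' Ht)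
     (vsmooth_has_deriv I _ t Hb' Ht)).
  fold W in Hd; rewrite (dot_sym (vderive (vderive b) t)) in Hd.
  change (is_derive W t (dot (vderive b t) (vderive (vderive b) t) +
         dot (vderive b t) (vderive (vderive b) t))) in Hd.
  assert (HS := sqrt_lt_R0 _ HWt).
  assert (HSS := sqrt_sqrt _ (Rlt_le _ _ HWt)).
  auto_derive.
  - split; [eexists; exact Hd|split; [exact HWt|split; [lra|exact Logic.I]]].
  - rewrite (is_derive_unique (fun x : R => W x) _ _ Hd).
    set (S := sqrt (W t)) in *; rewrite <- HSS; field; lra. }
destruct (open_interval_inhabited I HI) as [t0 Ht0].
assert (Hc : forall s t, I s -> I t ->
  vscal (/ sqrt (W s)) (n s) = vscal (/ sqrt (W t)) (n t)).
{ apply (vderive_zero_constant I (fun s => vscal (/ sqrt (W s)) (n s))); auto.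
  intros t Ht; eapply has_deriv_eq;
    [exact (has_deriv_scal _ _ _ _ _ (HW t Ht) (Hn t Ht))|].
  destruct (Hp t Ht) as (H1 & H0 & HWt & Hg); fold (W t) in HWt.
  assert (HS := sqrt_lt_R0 _ HWt).
  set (b0 := b t) in *; set (b1 := vderive b t) in *; set (b2 := vderive (vderive b) t) in *.
  (* The component of b'' orthogonal to b' is parallel to b. *)
  assert (E : vscal (W t) (cross b0 b2) = vscal (dot b1 b2) (n t)).
  { assert (E1 : vsub (vscal (W t) (cross b0 b2)) (vscal (dot b1 b2) (n t))
      = vsub (vscal (- dot (cross b0 b1) b2) b1) (vscal (dot b0 b1) (cross b2 b1))).
    { unfold W, n; fold b0 b1; vec_ring. }
    unfold director_triple in Hg; fold b0 b1 b2 in Hg; rewrite Hg, H0 in E1.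
    vec_lra E1. }
  assert (E2 : cross b0 b2 = vscal (dot b1 b2 / W t) (n t)).
  { transitivity (vscal (/ W t) (vscal (W t) (cross b0 b2))).
    - apply vec_ext; coords; field; lra.
    - rewrite E; apply vec_ext; coords; field; lra. }
  rewrite E2; apply vec_ext; coords; field; lra. }
exists (vscal (/ sqrt (W t0)) (n t0)); split.
- destruct (Hp t0 Ht0) as (H1 & H0 & HWt & _); fold (W t0) in HWt.
  assert (HS := sqrt_lt_R0 _ HWt).
  assert (HSS := sqrt_sqrt _ (Rlt_le _ _ HWt)).
  transitivity (/ sqrt (W t0) * / sqrt (W t0) * dot (n t0) (n t0)); [vec_ring|].
  unfold n; rewrite lagrange_identity, H0, H1; fold (W t0).
  set (S := sqrt (W t0)) in *; rewrite <- HSS; field; lra.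
- intros t Ht; rewrite (Hc t0 t Ht0 Ht).
  destruct (Hp t Ht) as (_ & _ & HWt & _); fold (W t) in HWt.
  assert (HS := sqrt_lt_R0 _ HWt).
  unfold vnorm; fold (n t) (W t); apply vec_ext; coords; field; lra.
Qed.

Lemma cross_unit_frame e f : dot e e = 1 -> dot f f = 1 -> dot e f = 0 ->
  dot (cross e f) (cross e f) = 1.
Proof. intros H1 H2 H3; rewrite lagrange_identity, H1, H2, H3; ring. Qed.

(** Since a' = c w e, where w = |b'| is the angular velocity of [b] in its
great circle, the height of [a] along [e] divided by [c] is an angle function of
[b]; this is [theta] below. *)
Lemma planar_director_helicoid I J a b c : open_interval I -> open_interval J ->
  vsmooth_on I a -> vsmooth_on I b -> striction_line I a b -> c <> 0 ->
  (forall t, I t -> vderive a t = vscal c (cross (b t) (vderive b t))) ->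
  (forall t, I t -> director_triple b t = 0) ->
  piece_of_helicoid (image I J (ruled a b)).
Proof.
intros HI HJ Ha Hb Hs Hc Hv Hg.
assert (H0 := striction_orthogonal I a b HI Hb Hs).
destruct (planar_director_axis I b HI Hb) as (e & He & Hn).
{ intros t Ht; destruct (Hs t Ht) as (H1 & _ & H3); auto. }
destruct (open_interval_inhabited I HI) as [t0 Ht0].
set (w := fun t => vnorm (vderive b t)) in *.
assert (Hw : forall t, I t -> 0 < w t) by (intros t Ht; apply sqrt_lt_R0, Hs, Ht).
assert (Hb1 : forall t, I t -> vderive b t = vscal (w t) (cross e (b t))).
{ intros t Ht; destruct (Hs t Ht) as (H1 & _).
  transitivity (cross (cross (b t) (vderive b t)) (b t)).
  - transitivity (vsub (vscal (dot (b t) (b t)) (vderive b t))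
      (vscal (dot (b t) (vderive b t)) (b t))); [rewrite H1, H0 by exact Ht|]; vec_ring.
  - rewrite Hn by exact Ht; fold (w t); vec_ring. }
assert (Hbe : forall t, I t -> dot e (b t) = 0).
{ intros t Ht; assert (E : dot (cross (b t) (vderive b t)) (b t) = 0) by vec_ring.
  rewrite (Hn t Ht) in E; fold (w t) in E.
  assert (E2 : w t * dot e (b t) = 0) by (rewrite <- E; vec_ring).
  apply Rmult_integral in E2; specialize (Hw t Ht); destruct E2; [lra|assumption]. }
set (f := cross e (b t0)).
assert (Hb0 := proj1 (Hs t0 Ht0)); assert (He0 := Hbe t0 Ht0).
assert (Hff : dot f f = 1) by (apply cross_unit_frame; assumption).
assert (Hbf : dot (b t0) f = 0) by (unfold f; vec_ring).
assert (Hfe : dot f e = 0) by (unfold f; vec_ring).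
set (theta := fun t => dot (vsub (a t) (a t0)) e / c).
assert (Hth : forall t, I t -> is_derive theta t (w t)).
{ intros t Ht; unfold theta.
  assert (Hd : has_deriv (fun s => vsub (a s) (a t0)) t (vscal (c * w t) e)).
  { eapply has_deriv_eq.
    - apply has_deriv_add; [exact (vsmooth_has_deriv I a t Ha Ht)|apply has_deriv_const].
    - rewrite (Hv t Ht), (Hn t Ht); fold (w t); vec_ring. }
  eapply is_derive_eq.
  - exact (is_derive_Rmult _ _ _ _ _
      (has_deriv_dot _ _ _ _ _ Hd (has_deriv_const e t)) (is_derive_Rconst (/ c) t)).
  - cbv beta.
    transitivity (w t * dot e e * (c * / c)); [vec_ring|rewrite He; field; exact Hc]. }
assert (Hcos : forall t, I t -> is_derive (fun s => cos (theta s)) t (- sin (theta t) * w t)).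
{ intros t Ht; eapply is_derive_eq;
  [exact (is_derive_comp cos theta t _ _ (is_derive_cos _) (Hth t Ht))
  |apply Rmult_comm]. }
assert (Hsin : forall t, I t -> is_derive (fun s => sin (theta s)) t (cos (theta t) * w t)).
{ intros t Ht; eapply is_derive_eq;
  [exact (is_derive_comp sin theta t _ _ (is_derive_sin _) (Hth t Ht))
  |apply Rmult_comm]. }
assert (Hth0 : theta t0 = 0) by (unfold theta; replace (dot (vsub (a t0) (a t0)) e) with 0 by vec_ring;
  field; exact Hc).
assert (Ha_eq : forall t, I t -> a t = vadd (a t0) (vscal (c * theta t) e)).
{ intros t Ht.
  assert (E : vsub (a t) (vscal (c * theta t) e) = vsub (a t0) (vscal (c * theta t0) e)).
  { apply (vderive_zero_constant I (fun s => vsub (a s) (vscal (c * theta s) e))); auto.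
    intros s Hs'; eapply has_deriv_eq.
    - apply has_deriv_add; [exact (vsmooth_has_deriv I a s Ha Hs')|].
      apply (has_deriv_scal (fun _ => -1)); [apply is_derive_Rconst|].
      apply (has_deriv_scal (fun r => c * theta r)); [|apply has_deriv_const].
      apply (is_derive_Rmult (fun _ => c) theta); [apply is_derive_Rconst|exact (Hth s Hs')].
    - rewrite (Hv s Hs'), (Hn s Hs'); fold (w s); cbv beta; vec_ring. }
  rewrite Hth0 in E.
  vec_lra E. }
(* The inner product of two unit vectors, so it is 1 only where they agree. *)
set (P := fun t => dot (b t) (b t0) * cos (theta t) + dot (b t) f * sin (theta t)).
assert (HP : forall t, I t -> P t = 1).
{ intros t Ht; transitivity (P t0).
  2: { unfold P; rewrite Hth0, cos_0, sin_0, Hb0; ring. }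
  apply (derive_zero_constant I P); auto.
  intros s Hs'; eapply is_derive_eq.
  - apply is_derive_Rplus; apply is_derive_Rmult.
    + exact (has_deriv_dot _ _ _ _ _ (vsmooth_has_deriv I b s Hb Hs') (has_deriv_const (b t0) s)).
    + exact (Hcos s Hs').
    + exact (has_deriv_dot _ _ _ _ _ (vsmooth_has_deriv I b s Hb Hs') (has_deriv_const f s)).
    + exact (Hsin s Hs').
  - cbv beta; rewrite (Hb1 s Hs').
    assert (Ef : dot (vscal (w s) (cross e (b s))) f = w s * dot (b s) (b t0)).
    { unfold f; transitivity (w s * (dot e e * dot (b s) (b t0) - dot e (b t0) * dot e (b s)));
        [vec_ring|rewrite He, He0; ring]. }
    rewrite Ef.
    replace (dot (vscal (w s) (cross e (b s))) (b t0)) with (- (w s * dot (b s) f))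
      by (unfold f; vec_ring).
    replace (dot (b s) vzero) with 0 by vec_ring; ring. }
assert (Hb_eq : forall t, I t ->
  b t = vadd (vscal (cos (theta t)) (b t0)) (vscal (sin (theta t)) f)).
{ intros t Ht.
  set (r := vadd (vscal (cos (theta t)) (b t0)) (vscal (sin (theta t)) f)).
  assert (E : vsub (b t) r = vzero).
  { apply dot_self_eq0.
    assert (Hsc := sin2_cos2 (theta t)); unfold Rsqr in Hsc.
    transitivity (dot (b t) (b t) - 2 * P t
      + (cos (theta t) * cos (theta t) * dot (b t0) (b t0)
         + sin (theta t) * sin (theta t) * dot f f
         + 2 * cos (theta t) * sin (theta t) * dot (b t0) f)).
    - unfold P, r; vec_ring.
    - rewrite HP, (proj1 (Hs t Ht)), Hb0, Hff, Hbf by exact Ht; lra. }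
  vec_lra E. }
exists (fun p => vadd (a t0) (vadd (vscal (cx p) (b t0)) (vadd (vscal (cy p) f) (vscal (cz p) e)))),
  c, 0, (fun s => exists t, I t /\ theta t = s), J.
split; [|split; [exact Hc|split; [|split; [exact HJ|]]]].
- apply isometry_orthonormal_frame; auto; rewrite dot_sym; assumption.
- apply image_open_interval with (df := w); auto.
- assert (Heq : forall t u, I t ->
    ruled a b t u = vadd (a t0) (vadd (vscal (cx (helicoid c 0 (theta t) u)) (b t0))
      (vadd (vscal (cy (helicoid c 0 (theta t) u)) f) (vscal (cz (helicoid c 0 (theta t) u)) e)))).
  { intros t u Ht; unfold ruled; rewrite (Ha_eq t Ht), (Hb_eq t Ht); unfold helicoid; vec_ring. }
  intros p; split.
  + intros (t & u & Ht & Hu & ->); exists (theta t), u.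
    split; [exists t; auto|split; [exact Hu|apply Heq, Ht]].
  + intros (s & u & (t & Ht & <-) & Hu & ->); exists t, u.
    split; [exact Ht|split; [exact Hu|symmetry; apply Heq, Ht]].
Qed.

(** * Rulings of a piece of helicoid *)

(** Polarization.  It provides an orthonormal frame attached to [phi] without
showing that [phi] is affine. *)
Lemma isometry_dot phi p q : isometry phi ->
  dot (vsub (phi p) (phi vzero)) (vsub (phi q) (phi vzero)) = dot p q.
Proof.
intros Hphi.
assert (Hsq : forall p q, dot (vsub (phi p) (phi q)) (vsub (phi p) (phi q)) =
  dot (vsub p q) (vsub p q)) by (intros; rewrite <- !vnorm_sq, Hphi; reflexivity).
assert (H1 := Hsq p q); assert (H2 := Hsq p vzero); assert (H3 := Hsq q vzero).
set (A := vsub (phi p) (phi vzero)) in *; set (B := vsub (phi q) (phi vzero)) in *.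
replace (vsub (phi p) (phi q)) with (vsub A B) in H1 by (unfold A, B; vec_ring).
replace (dot (vsub A B) (vsub A B)) with (dot A A - 2 * dot A B + dot B B) in H1 by vec_ring.
replace (dot (vsub p q) (vsub p q)) with (dot p p - 2 * dot p q + dot q q) in H1 by vec_ring.
replace (dot (vsub p vzero) (vsub p vzero)) with (dot p p) in H2 by vec_ring.
replace (dot (vsub q vzero) (vsub q vzero)) with (dot q q) in H3 by vec_ring.
lra.
Qed.

(** Along the line, (x0 + x1 u) sin m = (y0 + y1 u) cos m with m affine in [u].
Differentiating twice leaves x1 cos m + y1 sin m = 0, and differentiating once
more shows that (x1, y1) is also orthogonal to (- sin m, cos m). *)
Lemma line_in_helicoid J a b x0 x1 y0 y1 z0 z1 : open_interval J -> a <> 0 ->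
  (forall u, J u -> exists s v, x0 + x1 * u = v * cos s /\ y0 + y1 * u = v * sin s /\
     z0 + z1 * u = a * s + b) ->
  z1 <> 0 -> x1 = 0 /\ y1 = 0.
Proof.
intros HJ Ha H Hz.
set (m := fun u => (z0 + z1 * u - b) / a).
set (k := z1 / a).
assert (Hk : k <> 0) by (unfold k, Rdiv; apply Rmult_integral_contrapositive; split;
  [exact Hz|apply Rinv_neq_0_compat, Ha]).
assert (Hm : forall u, is_derive m u k) by (intros u; unfold m, k; auto_derive; [exact Logic.I|field; exact Ha]).
assert (Hs : forall u, is_derive (fun u => sin (m u)) u (k * cos (m u)))
  by (intros u; exact (is_derive_comp sin m u _ _ (is_derive_sin _) (Hm u))).
assert (Hc : forall u, is_derive (fun u => cos (m u)) u (k * - sin (m u)))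
  by (intros u; exact (is_derive_comp cos m u _ _ (is_derive_cos _) (Hm u))).
assert (Hl : forall p q u, is_derive (fun u => p + q * u) u q)
  by (intros p q u; auto_derive; [exact Logic.I|ring]).
assert (F0 : forall u, J u -> (x0 + x1 * u) * sin (m u) - (y0 + y1 * u) * cos (m u) = 0).
{ intros u Hu; destruct (H u Hu) as (s & v & -> & -> & E).
  replace (m u) with s by (unfold m; rewrite E; field; exact Ha); ring. }
assert (F1 : forall u, J u -> (x1 + k * (y0 + y1 * u)) * sin (m u)
   + (k * (x0 + x1 * u) - y1) * cos (m u) = 0).
{ intros u Hu; apply (zero_on_derive J _ HJ F0 u _ Hu).
  eapply is_derive_eq.
  - apply is_derive_Rminus; apply is_derive_Rmult; auto.
  - cbv beta; ring. }
assert (F2 : forall u, J u -> x1 * cos (m u) + y1 * sin (m u) = 0).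
{ intros u Hu.
  assert (E : 2 * k * (x1 * cos (m u) + y1 * sin (m u)) = 0).
  { apply (zero_on_derive J _ HJ F1 u _ Hu).
    eapply is_derive_eq.
    - apply is_derive_Rplus; apply is_derive_Rmult; auto.
      + apply is_derive_Rplus; [apply is_derive_Rconst|].
        apply is_derive_Rmult; [apply is_derive_Rconst|apply Hl].
      + apply is_derive_Rminus; [|apply is_derive_Rconst].
        apply is_derive_Rmult; [apply is_derive_Rconst|apply Hl].
    - cbv beta.
      transitivity (2 * k * (x1 * cos (m u) + y1 * sin (m u))
        - k ^ 2 * ((x0 + x1 * u) * sin (m u) - (y0 + y1 * u) * cos (m u))); [ring|].
      rewrite (F0 u Hu); ring. }
  apply Rmult_integral in E; destruct E as [E|E]; [lra|exact E]. }
assert (F3 : forall u, J u -> y1 * cos (m u) - x1 * sin (m u) = 0).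
{ intros u Hu.
  assert (E : k * (y1 * cos (m u) - x1 * sin (m u)) = 0).
  { apply (zero_on_derive J _ HJ F2 u _ Hu).
    eapply is_derive_eq.
    - apply is_derive_Rplus; apply is_derive_Rmult; auto; apply is_derive_Rconst.
    - cbv beta; ring. }
  apply Rmult_integral in E; destruct E as [E|E]; [lra|exact E]. }
destruct (open_interval_inhabited J HJ) as [u Hu].
specialize (F2 u Hu); specialize (F3 u Hu).
assert (Hsc := sin2_cos2 (m u)); unfold Rsqr in Hsc.
assert (E : x1 * x1 + y1 * y1 = 0).
{ transitivity ((x1 * cos (m u) + y1 * sin (m u)) ^ 2 + (y1 * cos (m u) - x1 * sin (m u)) ^ 2
     + (x1 * x1 + y1 * y1) * (1 - (sin (m u) * sin (m u) + cos (m u) * cos (m u)))); [ring|].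
  rewrite F2, F3, Hsc; ring. }
split; nra.
Qed.

(** Both [p] and [q] are multiples of e x f. *)
Lemma orthogonal_pair_span p q e f : dot e e = 1 -> dot f f = 1 -> dot e f = 0 ->
  dot p e = 0 -> dot p f = 0 -> dot q e = 0 -> dot q f = 0 -> dot p q = 0 ->
  p = vzero \/ q = vzero.
Proof.
intros He Hf Hef Hpe Hpf Hqe Hqf Hpq.
set (n := cross e f).
assert (Hn : dot n n = 1) by (apply cross_unit_frame; assumption).
assert (Hpar : forall r, dot r e = 0 -> dot r f = 0 -> r = vscal (dot n r) n).
{ intros r Hre Hrf.
  assert (E := cross_cross n n r).
  replace (cross n r) with (vsub (vscal (dot r e) f) (vscal (dot r f) e)) in E
    by (unfold n; vec_ring).
  rewrite Hre, Hrf, Hn in E.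
  clearbody n; vec_lra E. }
assert (Hp := Hpar p Hpe Hpf); assert (Hq := Hpar q Hqe Hqf).
assert (E : dot n p * dot n q = 0).
{ transitivity (dot (vscal (dot n p) n) (vscal (dot n q) n)).
  - transitivity (dot n p * dot n q * dot n n); [rewrite Hn; ring|vec_ring].
  - rewrite <- Hp, <- Hq; exact Hpq. }
apply Rmult_integral in E; destruct E as [E|E]; [left; rewrite Hp, E|right; rewrite Hq, E];
  vec_ring.
Qed.

(** A ruling with a vertical component is parallel to the axis by
[line_in_helicoid].  This would then hold for all nearby rulings, so that b and
b' would be two nonzero orthogonal vectors with the same direction. *)
Lemma helicoid_rulings_horizontal I J a b : open_interval I -> open_interval J ->
  vsmooth_on I b -> striction_line I a b ->
  piece_of_helicoid (image I J (ruled a b)) ->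
  exists e, dot e e = 1 /\ forall t, I t -> dot (b t) e = 0.
Proof.
intros HI HJ Hb Hs (phi & h & k & I' & J' & Hphi & Hh & _ & _ & Himg).
set (o := phi vzero).
set (e1 := vsub (phi (1, 0, 0)) o); set (e2 := vsub (phi (0, 1, 0)) o);
set (e3 := vsub (phi (0, 0, 1)) o).
assert (Hdot := isometry_dot phi).
assert (H11 : dot e1 e1 = 1) by (unfold e1, o; rewrite Hdot by assumption; vec_ring).
assert (H22 : dot e2 e2 = 1) by (unfold e2, o; rewrite Hdot by assumption; vec_ring).
assert (H33 : dot e3 e3 = 1) by (unfold e3, o; rewrite Hdot by assumption; vec_ring).
assert (H12 : dot e1 e2 = 0) by (unfold e1, e2, o; rewrite Hdot by assumption; vec_ring).
exists e3; split; [exact H33|].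
assert (Hline : forall t, I t -> dot (b t) e3 <> 0 -> dot (b t) e1 = 0 /\ dot (b t) e2 = 0).
{ intros t Ht Hz.
  apply (line_in_helicoid J h k (dot (vsub (a t) o) e1) _ (dot (vsub (a t) o) e2) _
     (dot (vsub (a t) o) e3) (dot (b t) e3) HJ Hh); [|exact Hz].
  intros u Hu.
  destruct (proj1 (Himg (ruled a b t u))) as (s & v & _ & _ & E).
  { exists t, u; auto. }
  exists s, v.
  assert (Hco : forall e, dot (vsub (a t) o) e + dot (b t) e * u =
     dot (vsub (phi (helicoid h k s v)) o) e).
  { intros e; rewrite <- E; unfold ruled; vec_ring. }
  rewrite !Hco; unfold e1, e2, e3, o; rewrite !Hdot by assumption; unfold helicoid.
  repeat split; vec_ring. }
intros t Ht.
destruct (Req_dec (dot (b t) e3) 0) as [E|Hz]; [exact E|exfalso].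
assert (Hd : forall e, is_derive (fun s => dot (b s) e) t (dot (vderive b t) e)).
{ intros e; eapply is_derive_eq;
  [exact (has_deriv_dot _ _ _ _ _ (vsmooth_has_deriv I b t Hb Ht) (has_deriv_const e t))
  |vec_ring]. }
assert (Hnear : locally t (fun s => dot (b s) e3 <> 0 /\ I s)).
{ apply filter_and; [|apply open_interval_locally; assumption].
  apply (ex_derive_continuous (fun s => dot (b s) e3) t (ex_intro _ _ (Hd e3))
    (fun y => y <> 0)).
  apply (open_neq 0); exact Hz. }
assert (Hder : forall e, (forall s, I s -> dot (b s) e3 <> 0 -> dot (b s) e = 0) ->
  dot (vderive b t) e = 0).
{ intros e He; rewrite <- (is_derive_unique _ _ _ (Hd e)).
  rewrite (Derive_ext_loc _ (fun _ => 0)); [apply Derive_const|].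
  revert Hnear; apply filter_imp; intros s [Hz' Hs']; apply He; assumption. }
destruct (Hline t Ht Hz) as [Hb1 Hb2].
destruct (Hs t Ht) as (Hbb & _ & Hw).
destruct (orthogonal_pair_span (b t) (vderive b t) e1 e2) as [E|E]; auto.
- apply Hder; intros s Hs' Hz'; apply (Hline s Hs' Hz').
- apply Hder; intros s Hs' Hz'; apply (Hline s Hs' Hz').
- apply (striction_orthogonal I a b); assumption.
- rewrite E in Hbb; coords; lra.
- rewrite E in Hw; coords; lra.
Qed.

(** The derivatives b' and b'' remain in the plane of [b]. *)
Lemma planar_director_triple I b e : open_interval I -> vsmooth_on I b ->
  dot e e = 1 -> (forall t, I t -> dot (b t) e = 0) ->
  forall t, I t -> director_triple b t = 0.
Proof.
intros HI Hb He Hbe.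
assert (Hb' := vsmooth_vderive I b Hb).
assert (Hstep : forall p, vsmooth_on I p -> (forall t, I t -> dot (p t) e = 0) ->
  forall t, I t -> dot (vderive p t) e = 0).
{ intros p Hp Hpe t Ht; apply (zero_on_derive I _ HI Hpe t _ Ht); eapply is_derive_eq;
  [exact (has_deriv_dot _ _ _ _ _ (vsmooth_has_deriv I p t Hp Ht) (has_deriv_const e t))
  |vec_ring]. }
assert (H1 := Hstep b Hb Hbe); assert (H2 := Hstep _ Hb' H1).
intros t Ht; apply (coplanar_triple e); auto; lra.
Qed.

(** * Constant mean curvature and helicoids *)

(** For fixed [t], squaring the formula for H turns constancy in [u] into a
polynomial identity in [u]: H0^2 (c^2 + u^2) is constant only if H0 = 0. *)
Lemma constant_mean_curvature_triple I J a b c : open_interval I -> open_interval J ->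
  vsmooth_on I a -> vsmooth_on I b -> striction_line I a b -> c <> 0 ->
  (forall t, I t -> vderive a t = vscal c (cross (b t) (vderive b t))) ->
  constant_mean_curvature I J (ruled a b) ->
  forall t, I t -> director_triple b t = 0.
Proof.
intros HI HJ Ha Hb Hs Hc Hv (H0 & HH) t Ht.
destruct (Hs t Ht) as (_ & _ & HW).
assert (Hw : 0 < vnorm (vderive b t)) by (apply sqrt_lt_R0, HW).
set (w := vnorm (vderive b t)) in *; set (g := director_triple b t) in *.
assert (Hpoly : forall u, J u -> g ^ 2 = 4 * w ^ 6 * H0 ^ 2 * (c ^ 2 + u ^ 2)).
{ intros u Hu; assert (E := HH t u Ht Hu).
  rewrite (ruled_mean_curvature I a b c) in E by assumption; fold w g in E.
  assert (HD : 0 < c ^ 2 + u ^ 2) by nra.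
  assert (HS := sqrt_lt_R0 _ HD); assert (HSS := sqrt_sqrt _ (Rlt_le _ _ HD)).
  set (S := sqrt (c ^ 2 + u ^ 2)) in *.
  rewrite <- HSS, <- E; field; lra. }
destruct (quartic_vanishing J (4 * w ^ 6 * H0 ^ 2 * c ^ 2 - g ^ 2) 0 (4 * w ^ 6 * H0 ^ 2) 0 0 HJ)
  as (E0 & _ & E2 & _).
{ intros u Hu; rewrite (Hpoly u Hu); ring. }
rewrite E2 in E0; nra.
Qed.

Lemma constant_mean_curvature_iff I J a b : non_developable_ruled_ricci I J a b ->
  constant_mean_curvature I J (ruled a b) <-> piece_of_helicoid (image I J (ruled a b)).
Proof.
intros HR.
destruct (ricci_striction I J a b HR) as (c & Hc & Hv).
destruct HR as (Hr & _).
assert (Hs := ruled_surface_striction_line I J a b Hr).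
destruct Hr as (HI & HJ & Ha & Hb & _).
split; intros H.
- apply (planar_director_helicoid I J a b c); auto.
  apply (constant_mean_curvature_triple I J a b c); assumption.
- destruct (helicoid_rulings_horizontal I J a b HI HJ Hb Hs H) as (e & He & Hbe).
  exists 0; intros t u Ht Hu.
  rewrite (ruled_mean_curvature I a b c) by assumption.
  rewrite (planar_director_triple I b e) by assumption.
  unfold Rdiv; ring.
Qed.

(** * Frenet frame of the line of striction *)

Lemma regular_curve_tangent I alpha t : regular_curve I alpha -> I t ->
  0 < speed alpha t /\ dot (tangent alpha t) (tangent alpha t) = 1 /\
  vderive alpha t = vscal (speed alpha t) (tangent alpha t) /\
  has_deriv (tangent alpha) t (vderive (tangent alpha) t).
Proof.
intros [Ha Hreg] Ht.
assert (Hv : 0 < speed alpha t) by (apply vnorm_pos, Hreg, Ht).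
split; [exact Hv|split; [|split]].
- transitivity (/ speed alpha t * / speed alpha t * dot (vderive alpha t) (vderive alpha t)).
  + unfold tangent, arc_derive; vec_ring.
  + rewrite <- vnorm_sq; fold (speed alpha t); field; lra.
- unfold tangent, arc_derive; apply vec_ext; coords; field; lra.
- assert (Ha' := vsmooth_vderive I alpha Ha).
  assert (Hd := vsmooth_has_deriv I _ t Ha' Ht).
  assert (HW := has_deriv_dot _ _ _ _ _ Hd Hd).
  assert (HWp := dot_self_pos _ (Hreg t Ht)).
  assert (Hs : exists k : R, is_derive (fun s => / speed alpha s) t k).
  { set (W := fun s => dot (vderive alpha s) (vderive alpha s)).
    change (exists k : R, is_derive (fun s => / sqrt (W s)) t k).
    apply (ex_derive_ext (fun s => / sqrt (W s))); [reflexivity|].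
    auto_derive.
    assert (HS := sqrt_lt_R0 _ HWp); fold (W t) in HS, HWp.
    split; [eexists; exact HW|split; [exact HWp|split; [lra|exact Logic.I]]]. }
  destruct Hs as [k Hk].
  assert (H := has_deriv_scal _ _ _ _ _ Hk Hd).
  change (has_deriv (tangent alpha) t
    (vadd (vscal k (vderive alpha t)) (vscal (/ speed alpha t) (vderive (vderive alpha) t)))) in H.
  rewrite (has_deriv_unique _ _ _ H); exact H.
Qed.

Lemma constant_dot_derive I p q t p1 q1 k : open_interval I ->
  (forall s, I s -> dot (p s) (q s) = k) -> I t -> has_deriv p t p1 -> has_deriv q t q1 ->
  dot p1 (q t) + dot (p t) q1 = 0.
Proof.
intros HI Hk Ht Hp Hq.
replace (dot p1 (q t) + dot (p t) q1) with (dot p1 (q t) + dot (p t) q1 - 0) by ring.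
apply (zero_on_derive I (fun s => dot (p s) (q s) - k) HI) with (t := t); [|exact Ht|].
- intros s Hs; rewrite (Hk s Hs); ring.
- apply is_derive_Rminus; [apply has_deriv_dot; assumption|apply is_derive_Rconst].
Qed.

Lemma parallel_derive I q e t q1 : open_interval I ->
  (forall s, I s -> cross (q s) e = vzero) -> I t -> has_deriv q t q1 -> cross q1 e = vzero.
Proof.
intros HI Hq Ht Hd.
rewrite <- (has_deriv_unique (fun s => cross (q s) e) t (cross q1 e)).
- apply has_deriv_unique, (has_deriv_ext_loc (fun _ => vzero)); [|apply has_deriv_const].
  apply (locally_on I); auto; intros s Hs; symmetry; auto.
- eapply has_deriv_eq; [exact (has_deriv_cross _ _ _ _ _ Hd (has_deriv_const e t))|vec_ring].
Qed.

Lemma parallel_unit r e : dot e e = 1 -> cross r e = vzero -> r = vscal (dot e r) e.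
Proof.
intros He Hr; assert (E := cross_cross e r e); rewrite Hr, He in E.
vec_lra E.
Qed.

(** The derivative of the unit tangent is both parallel to the line and
orthogonal to the tangent. *)
Lemma straight_line_curvature I alpha p e t : open_interval I -> regular_curve I alpha ->
  dot e e = 1 -> (forall s, I s -> exists r, alpha s = vadd p (vscal r e)) -> I t ->
  curvature alpha t = 0.
Proof.
intros HI Hreg He Hline Ht.
assert (HT := fun s Hs => regular_curve_tangent I alpha s Hreg Hs).
assert (H1 : forall s, I s -> cross (vderive alpha s) e = vzero).
{ intros s Hs; apply (parallel_derive I (fun s => vsub (alpha s) p) e s); auto.
  - intros r Hr; destruct (Hline r Hr) as [k ->]; vec_ring.
  - eapply has_deriv_eq.
    + apply has_deriv_add; [exact (vsmooth_has_deriv I alpha s (proj1 Hreg) Hs)|apply has_deriv_const].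
    + vec_ring. }
assert (H2 : forall s, I s -> cross (tangent alpha s) e = vzero).
{ intros s Hs; transitivity (vscal (/ speed alpha s) (cross (vderive alpha s) e)).
  - unfold tangent, arc_derive; vec_ring.
  - rewrite (H1 s Hs); vec_ring. }
destruct (HT t Ht) as (_ & HTT & _ & Hd).
assert (H3 := parallel_derive I _ e t _ HI H2 Ht Hd).
assert (H4 := constant_dot_derive I _ _ t _ _ 1 HI (fun s Hs => proj1 (proj2 (HT s Hs))) Ht Hd Hd).
set (T := tangent alpha t) in *; set (T1 := vderive (tangent alpha) t) in *.
assert (E1 := parallel_unit T1 e He H3); assert (E := parallel_unit T e He (H2 t Ht)).
assert (HTe : dot e T * dot e T = 1).
{ rewrite <- HTT; rewrite E at 3 4.
  transitivity (dot e T * dot e T * dot e e); [rewrite He; ring|vec_ring]. }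
assert (HT1e : dot e T * dot e T1 = 0).
{ transitivity (dot T T1); [|rewrite (dot_sym T1) in H4; lra].
  rewrite E at 2; vec_ring. }
assert (E2 : T1 = vzero).
{ rewrite E1; replace (dot e T1) with 0; [vec_ring|].
  transitivity (dot e T * (dot e T * dot e T1));
    [rewrite HT1e; ring|transitivity (dot e T * dot e T * dot e T1); [ring|rewrite HTe; ring]]. }
unfold curvature, arc_derive; fold T1; rewrite E2; unfold vnorm.
replace (dot _ _) with 0 by vec_ring; apply sqrt_0.
Qed.

Lemma orthonormal_determined p q e f : dot e e = 1 -> dot f f = 1 -> dot e f = 0 ->
  dot p e = dot q e -> dot p f = dot q f -> dot p (cross e f) = dot q (cross e f) -> p = q.
Proof.
intros He Hf Hef H1 H2 H3.
assert (Hn := cross_unit_frame e f He Hf Hef).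
set (d := vsub p q).
assert (D1 : dot d e = 0) by (transitivity (dot p e - dot q e); [unfold d; vec_ring|lra]).
assert (D2 : dot d f = 0) by (transitivity (dot p f - dot q f); [unfold d; vec_ring|lra]).
assert (D3 : dot d (cross e f) = 0)
  by (transitivity (dot p (cross e f) - dot q (cross e f)); [unfold d; vec_ring|lra]).
assert (E : d = vzero).
{ destruct (orthogonal_pair_span d (cross e f) e f) as [E|E]; auto; try vec_ring.
  rewrite E in Hn; coords; lra. }
unfold d in E; vec_lra E.
Qed.

(** B' = v tau N because B' is orthogonal to B, and to T since
<B', T> = - <B, T'> = 0.  Then B x B' = - v tau T, and differentiating
<B', T> = 0 once more gives <B'', T> = - <B', T'> = - v^2 tau kappa. *)
Lemma binormal_director I alpha beta tau0 t : open_interval I ->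
  regular_curve I alpha -> vsmooth_on I beta ->
  (forall t, I t -> curvature alpha t <> 0 /\ torsion alpha t = tau0 /\
     beta t = binormal alpha t) -> I t ->
  dot (vderive beta t) (vderive beta t) = (speed alpha t * tau0) ^ 2 /\
  director_triple beta t = speed alpha t ^ 3 * tau0 ^ 2 * curvature alpha t.
Proof.
intros HI Hreg Hb HF Ht.
assert (HT := fun s Hs => regular_curve_tangent I alpha s Hreg Hs).
assert (HT' : forall s, I s -> vderive (tangent alpha) s =
  vscal (speed alpha s * curvature alpha s) (normal alpha s)).
{ intros s Hs; destruct (HT s Hs) as (Hv & _); destruct (HF s Hs) as (Hk & _).
  unfold normal, arc_derive; apply vec_ext; coords; field; split; auto; lra. }
assert (HN : forall s, I s -> dot (normal alpha s) (normal alpha s) = 1).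
{ intros s Hs; destruct (HF s Hs) as (Hk & _).
  transitivity (/ curvature alpha s * / curvature alpha s *
    dot (arc_derive alpha (tangent alpha) s) (arc_derive alpha (tangent alpha) s));
    [unfold normal; vec_ring|].
  rewrite <- vnorm_sq; fold (curvature alpha s); field; exact Hk. }
assert (HTN : forall s, I s -> dot (tangent alpha s) (normal alpha s) = 0).
{ intros s Hs; destruct (HT s Hs) as (Hv & _ & _ & Hd); destruct (HF s Hs) as (Hk & _).
  assert (E := constant_dot_derive I _ _ s _ _ 1 HI (fun s Hs => proj1 (proj2 (HT s Hs))) Hs Hd Hd).
  rewrite (HT' s Hs) in E.
  assert (E2 : speed alpha s * curvature alpha s * dot (tangent alpha s) (normal alpha s) = 0).
  { apply Rmult_eq_reg_l with 2; [|lra]; rewrite Rmult_0_r, <- E; vec_ring. }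
  apply Rmult_integral in E2; destruct E2 as [E2|E2]; [|exact E2].
  apply Rmult_integral in E2; destruct E2; [lra|contradiction]. }
assert (HB1 : forall s, I s -> vderive beta s = vscal (speed alpha s * tau0) (normal alpha s)).
{ intros s Hs; destruct (HT s Hs) as (Hv & HTT & _ & Hd); destruct (HF s Hs) as (Hk & Htau & Hbs).
  assert (Hdb := vsmooth_has_deriv I beta s Hb Hs).
  assert (HB : binormal alpha s = cross (tangent alpha s) (normal alpha s)) by reflexivity.
  apply (orthonormal_determined _ _ (tangent alpha s) (normal alpha s)); auto.
  - assert (HBT : forall r, I r -> dot (beta r) (tangent alpha r) = 0).
    { intros r Hr; rewrite (proj2 (proj2 (HF r Hr))); unfold binormal; vec_ring. }
    assert (E := constant_dot_derive I _ _ s _ _ 0 HI HBT Hs Hdb Hd).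
    rewrite (HT' s Hs), Hbs, HB in E.
    transitivity (speed alpha s * tau0 * dot (tangent alpha s) (normal alpha s));
      [|vec_ring].
    rewrite (HTN s Hs), Rmult_0_r, <- E; vec_ring.
  - assert (E : vderive (binormal alpha) s = vderive beta s).
    { apply has_deriv_unique, (has_deriv_ext_loc beta); [|exact Hdb].
      apply (locally_on I); auto; intros r Hr; apply HF, Hr. }
    transitivity (speed alpha s * tau0); [|transitivity (speed alpha s * tau0 *
      dot (normal alpha s) (normal alpha s)); [rewrite (HN s Hs); ring|vec_ring]].
    rewrite <- Htau; unfold torsion, arc_derive; rewrite E.
    transitivity (speed alpha s * / speed alpha s * dot (vderive beta s) (normal alpha s));
      [field; lra|vec_ring].
  - assert (HBB : forall r, I r -> dot (beta r) (beta r) = 1).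
    { intros r Hr; rewrite (proj2 (proj2 (HF r Hr)));
        apply cross_unit_frame; [apply HT|apply HN|apply HTN]; exact Hr. }
    assert (E := constant_dot_derive I _ _ s _ _ 1 HI HBB Hs Hdb Hdb).
    rewrite (dot_sym (beta s)) in E; rewrite <- HB, <- Hbs.
    transitivity 0; [lra|]; rewrite Hbs, HB; vec_ring. }
split.
- rewrite (HB1 t Ht).
  transitivity ((speed alpha t * tau0) ^ 2 * dot (normal alpha t) (normal alpha t));
    [vec_ring|rewrite (HN t Ht); ring].
- destruct (HT t Ht) as (Hv & HTT & _ & Hd); destruct (HF t Ht) as (_ & _ & Hbt).
  assert (Hdb := vsmooth_has_deriv I _ t (vsmooth_vderive I beta Hb) Ht).
  assert (HB1T : forall r, I r -> dot (vderive beta r) (tangent alpha r) = 0).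
  { intros r Hr; rewrite (HB1 r Hr).
    transitivity (speed alpha r * tau0 * dot (tangent alpha r) (normal alpha r));
      [vec_ring|rewrite (HTN r Hr); ring]. }
  assert (E := constant_dot_derive I _ _ t _ _ 0 HI HB1T Ht Hdb Hd).
  rewrite (HT' t Ht) in E.
  set (b2 := vderive (vderive beta) t) in *.
  unfold director_triple; fold b2.
  rewrite (HB1 t Ht) in *; rewrite Hbt; unfold binormal.
  set (T := tangent alpha t) in *; set (N := normal alpha t) in *.
  set (v := speed alpha t) in *; set (k := curvature alpha t) in *.
  assert (HTNt := HTN t Ht); assert (HNt := HN t Ht); fold T N in HTNt, HNt.
  assert (E3 : cross (cross T N) (vscal (v * tau0) N) = vscal (- (v * tau0)) T).
  { transitivity (vscal (v * tau0) (vsub (vscal (dot T N) N) (vscal (dot N N) T))); [vec_ring|].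
    rewrite HTNt, HNt; vec_ring. }
  rewrite E3.
  transitivity (- (v * tau0) * dot b2 T); [vec_ring|].
  assert (E4 : dot (vscal (v * tau0) N) (vscal (v * k) N) = v * tau0 * (v * k) * dot N N) by vec_ring.
  rewrite E4, HNt in E.
  replace (dot b2 T) with (- (v * tau0 * (v * k))) by lra; ring.
Qed.

(** * The mean curvature formula and its consequence *)

Theorem theorem3 :
  (forall (I J : R -> Prop) (alpha beta : R -> vec3) (tau0 : R),
     non_developable_ruled_ricci I J alpha beta ->
     canonical_parametrization I J alpha beta tau0 ->
     forall t u : R, I t -> J u ->
       mean_curvature (ruled alpha beta) t u
       = - (curvature alpha t / (2 * sqrt (1 + tau0 ^ 2 * u ^ 2))))
  /\
  (forall (I J : R -> Prop) (alpha beta : R -> vec3),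
     non_developable_ruled_ricci I J alpha beta ->
     (constant_mean_curvature I J (ruled alpha beta) <->
      piece_of_helicoid (image I J (ruled alpha beta)))).
Proof.
split; [|exact constant_mean_curvature_iff].
intros I J a b tau HR [Hreg Hcan] t u Ht Hu.
destruct (ricci_striction I J a b HR) as (c & Hc & Hv).
destruct HR as (Hr & _).
assert (Hs := ruled_surface_striction_line I J a b Hr).
destruct Hr as (HI & HJ & Ha & Hb & _).
rewrite (ruled_mean_curvature I a b c) by assumption.
destruct Hcan as [[Htau HF]|[(p & e & He & Hline) _]].
- destruct (binormal_director I a b tau t HI Hreg Hb HF Ht) as [HW ->].
  destruct (regular_curve_tangent I a t Hreg Ht) as (Hsp & _).
  set (v := speed a t) in *; set (k := curvature a t).
  assert (Hcv : v * v = c ^ 2 * (v * tau) ^ 2).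
  { unfold v at 1 2, speed; rewrite vnorm_sq, (Hv t Ht).
    transitivity (c ^ 2 * dot (cross (b t) (vderive b t)) (cross (b t) (vderive b t))); [vec_ring|].
    rewrite lagrange_identity, HW, (proj1 (Hs t Ht)), (striction_orthogonal I a b) by assumption.
    ring. }
  assert (Hct : c ^ 2 * tau ^ 2 = 1).
  { apply Rmult_eq_reg_l with (v * v); [|nra]. rewrite Rmult_1_r; rewrite Hcv at 2; ring. }
  assert (Hat : 0 < Rabs tau) by (apply Rabs_pos_lt, Htau).
  assert (Hw : vnorm (vderive b t) = v * Rabs tau).
  { unfold vnorm; rewrite HW.
    rewrite <- (Rabs_pos_eq v) at 2 by lra; rewrite <- Rabs_mult.
    rewrite <- Rsqr_pow2; apply sqrt_Rsqr_abs. }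
  assert (HD : 0 < c ^ 2 + u ^ 2) by nra.
  assert (HS := sqrt_lt_R0 _ HD).
  assert (HSq : sqrt (1 + tau ^ 2 * u ^ 2) = Rabs tau * sqrt (c ^ 2 + u ^ 2)).
  { rewrite <- sqrt_Rsqr_abs, Rsqr_pow2, <- sqrt_mult by nra; f_equal; lra. }
  rewrite Hw, HSq, <- (pow2_abs tau); field; lra.
- assert (H0 : director_triple b t = 0).
  { apply (planar_director_triple I b e); auto; [apply dot_unit, He|].
    intros s Hs'; apply (Hline s Hs'). }
  rewrite H0, (straight_line_curvature I a p e); auto.
  + unfold Rdiv; ring.
  + apply dot_unit, He.
  + intros s Hs'; apply (Hline s Hs').
Qed.
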